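(* For all torsion-free abelian groups $G$ and $H$, $$K_{\mathbb Q}(G)\cong K_{\mathbb Q}(H)\quad\Longleftrightarrow\quad G\cong H,$$ where the left-hand isomorphism is an isomorphism of abstract fields and the right-hand one is an isomorphism of groups. The field isomorphism is not assumed to preserve either group algebra or its standard monomials.
   Context: Torsion-free abelian groups are written additively. No rank or cardinality restriction is imposed. For a field $k$ and a torsion-free abelian group $G$, the group algebra $k[G]$ has the formal monomials $X^g$, $g\in G$, as a $k$-basis, with multiplication determined by $X^gX^h=X^{g+h}$. Since $G$ is torsion-free abelian, $k[G]$ is an integral domain, and $K_k(G)=\operatorname{Frac} k[G]$ denotes its field of fractions. In particular $K_{\mathbb Q}(G)=\operatorname{Frac}\mathbb Q[G]$. *)

(* Defs.v *)
From HB Require Import structures.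
From mathcomp Require Import all_boot all_order all_algebra.
From mathcomp Require Import finmap.
From mathcomp Require Import monalg.

Set Implicit Arguments.
Unset Strict Implicit.
Unset Printing Implicit Defensive.

Import GRing.Theory.
Local Open Scope fset_scope.
Local Open Scope ring_scope.

HB.mixin Record Zmodule_isTorsionFree V of GRing.Zmodule V := {
  torsion_free_subproof :
    forall (x : V) (n : nat), (0 < n)%N -> x *+ n = 0 -> x = 0
}.

#[short(type="torsionFreeZmodType")]
HB.structure Definition TorsionFreeZmodule :=
  {V of GRing.Zmodule V & Zmodule_isTorsionFree V}.

Lemma mulrn_torsion_free (G : torsionFreeZmodType) (x : G) (n : nat) :
  (0 < n)%N -> x *+ n = 0 -> x = 0.
Proof. exact: torsion_free_subproof. Qed.

(* The ring structure that monalg puts on {malg k[M]} requires M to have no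
   invertible element other than the unit, which excludes groups; only the
   k-module structure of {malg k[G]} is reused here. *)
Definition group_algebra (k : fieldType) (G : zmodType) : Type := {malg k[G]}.

HB.instance Definition _ (k : fieldType) (G : zmodType) :=
  GRing.Lmodule.on (group_algebra k G).

Section GroupAlgebraRing.
Context (k : fieldType) (G : zmodType).
Implicit Types (p q r : group_algebra k G) (c : k) (g h : G).

(* the monomial X^g *)
Definition gmonom g : group_algebra k G := << 1 *g g >>.

Definition gone : group_algebra k G := gmonom 0.

(* the bilinear extension of X^g X^h = X^(g + h) *)
Definition gmul p q : group_algebra k G :=
  \sum_(g <- msupp p) \sum_(h <- msupp q) << p@_g * q@_h *g g + h >>.

Lemma gmulw (d1 d2 : {fset G}) p q :
    msupp p `<=` d1 -> msupp q `<=` d2 ->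
  gmul p q = \sum_(g <- d1) \sum_(h <- d2) << p@_g * q@_h *g g + h >>.
Proof.
move=> le_d1 le_d2; rewrite /gmul (big_fset_incl _ le_d1) /=.
  apply/eq_bigr=> g _; apply/big_fset_incl => // h _ /mcoeff_outdom ->.
  by rewrite mulr0 monalgU0.
move=> g _ /mcoeff_outdom pg.
by rewrite big1 => // h _; rewrite pg mul0r monalgU0.
Qed.

Lemma gmulC : commutative gmul.
Proof.
move=> p q; rewrite /gmul exchange_big /=; apply/eq_bigr=> g _.
by apply/eq_bigr=> h _; rewrite mulrC addrC.
Qed.

Lemma gmul0 : left_zero 0 gmul.
Proof. by move=> p; rewrite /gmul msupp0 big_seq_fset0. Qed.

Lemma gmulDl : left_distributive gmul +%R.
Proof.
move=> p q r.
rewrite (gmulw (msuppD_le p q) (fsubset_refl _)).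
rewrite (gmulw (fsubsetUl _ (msupp q)) (fsubset_refl (msupp r))).
rewrite (gmulw (fsubsetUr (msupp p) _) (fsubset_refl (msupp r))).
rewrite -big_split /=; apply/eq_bigr=> g _.
rewrite -big_split /=; apply/eq_bigr=> h _.
by rewrite mcoeffD mulrDl monalgUD.
Qed.

Lemma gmulDr : right_distributive gmul +%R.
Proof. by move=> p q r; rewrite gmulC gmulDl !(gmulC p). Qed.

Lemma gmulUU c1 c2 g h :
  gmul << c1 *g g >> << c2 *g h >> = << c1 * c2 *g g + h >>.
Proof. by rewrite (gmulw msuppU_le msuppU_le) !big_seq_fset1 !mcoeffUU. Qed.

Lemma gmulUl c g q :
  gmul << c *g g >> q = \sum_(h <- msupp q) << c * q@_h *g g + h >>.
Proof.
rewrite (gmulw msuppU_le (fsubset_refl _)) big_seq_fset1.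
by apply/eq_bigr => h _; rewrite mcoeffUU.
Qed.

Lemma gmul1 : left_id gone gmul.
Proof.
move=> p; rewrite gmulUl [RHS]monalgE.
by apply/eq_bigr=> g _; rewrite mul1r add0r.
Qed.

Lemma gmul_suml (I : Type) (s : seq I) (F : I -> group_algebra k G) q :
  gmul (\sum_(i <- s) F i) q = \sum_(i <- s) gmul (F i) q.
Proof. by apply: (big_morph (gmul^~ q)); [move=> ? ?; exact: gmulDl|exact: gmul0]. Qed.

Lemma gmul_sumr (I : Type) (s : seq I) (F : I -> group_algebra k G) p :
  gmul p (\sum_(i <- s) F i) = \sum_(i <- s) gmul p (F i).
Proof. by rewrite gmulC gmul_suml; apply/eq_bigr=> i _; rewrite gmulC. Qed.

Lemma gmulA : associative gmul.
Proof.
move=> p q r; rewrite [p]monalgE !(gmul_suml _ _ (gmul q r), gmul_suml _ _ q).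
rewrite gmul_suml; apply/eq_bigr=> g1 _.
rewrite [q]monalgE (gmul_suml _ _ r) !(gmul_sumr _ _ << _ *g g1 >>).
rewrite gmul_suml; apply/eq_bigr=> g2 _.
rewrite [r]monalgE (gmul_sumr _ _ << _ *g g2 >>) (gmul_sumr _ _ << _ *g g1 >>).
rewrite (gmul_sumr _ _ (gmul _ _)); apply/eq_bigr=> g3 _.
by rewrite !gmulUU mulrA addrA.
Qed.

Lemma gone_neq0 : gone != 0.
Proof. by rewrite monalgU_eq0 oner_eq0. Qed.

HB.instance Definition _ := GRing.Zmodule_isComNzRing.Build (group_algebra k G)
  gmulA gmulC gmul1 gmulDl gone_neq0.

Lemma gmonomD g h : gmonom (g + h) = gmonom g * gmonom h.
Proof. by rewrite [RHS]gmulUU mul1r. Qed.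

Lemma gmonom0 : gmonom 0 = 1.
Proof. by []. Qed.

Lemma gmonomE p : p = \sum_(g <- msupp p) p@_g *: gmonom g.
Proof.
rewrite [LHS]monalgE; apply/eq_bigr=> g _; apply/malgP=> h.
by rewrite mcoeffZ !mcoeffU mulrnAr mulr1.
Qed.

Lemma mcoeffgM p q g : (p * q)@_g =
  \sum_(x <- msupp p) \sum_(y <- msupp q) (p@_x * q@_y) *+ (x + y == g).
Proof.
rewrite [p * q]/(gmul p q) raddf_sum /=; apply/eq_bigr=> x _.
by rewrite raddf_sum /=; apply/eq_bigr=> y _; rewrite mcoeffU.
Qed.

Lemma gscaleAl c p q : c *: (p * q) = c *: p * q.
Proof.
apply/malgP=> g; rewrite mcoeffZ.
have -> : c *: p * q = \sum_(x <- msupp p) \sum_(y <- msupp q)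
    << (c *: p)@_x * q@_y *g x + y >>.
  exact: gmulw (msuppZ_le c p) (fsubset_refl _).
rewrite mcoeffgM raddf_sum mulr_sumr /=; apply/eq_bigr=> x _.
rewrite raddf_sum mulr_sumr /=; apply/eq_bigr=> y _.
by rewrite mcoeffU mcoeffZ -mulrA mulrnAr.
Qed.

HB.instance Definition _ :=
  GRing.Lmodule_isLalgebra.Build k (group_algebra k G) gscaleAl.
HB.instance Definition _ :=
  GRing.Lalgebra_isComAlgebra.Build k (group_algebra k G).

End GroupAlgebraRing.

(* A torsion-free abelian group has, relative to any finite set of elements,
   a positive cone; comparing supports by it yields unique extremal products,
   hence no zero divisors and only trivial units. *)
Section Cone.
Context (G : torsionFreeZmodType).

Definition cone (P : G -> Prop) (s : seq G) : Prop :=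
  [/\ P 0, forall x y, P x -> P y -> P (x + y),
      forall x, P x -> P (- x) -> x = 0
    & forall x, x \in s -> P x \/ P (- x)].

Lemma cone_opp P s : cone P s -> cone (fun x => P (- x)) s.
Proof.
case=> P0 PD Pa Ps; split.
- by rewrite oppr0.
- by move=> x y Px Py; rewrite opprD; exact: PD.
- by move=> x Px; rewrite opprK => PNx; exact: Pa.
- by move=> x /Ps; rewrite opprK; case; [right|left].
Qed.

Lemma cone_muln P s x n : cone P s -> P x -> P (x *+ n).
Proof.
case=> P0 PD _ _ Px; elim: n => [|n IH]; first by rewrite mulr0n.
by rewrite mulrS; exact: PD.
Qed.

Lemma cone_exists s : classically (exists P, cone P s).
Proof.
elim: s => [|g s IH].
  apply/classicP=> [[]]; exists (fun x => x = 0); split=> //.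
  by move=> x y -> ->; rewrite addr0.
move=> b hb; apply: IH => -[P cP]; have [P0 PD Pa Ps] := cP.
apply: (@classic_EM (exists n, P (- (g *+ n.+1)))) => hn; apply: hb.
case: hn => [[n Pn]|nP].
- exists (fun x => exists2 u, P u & exists m, x = u - g *+ m); split.
  + by exists 0 => //; exists 0%N; rewrite mulr0n subr0.
  + move=> x y [u Pu [m ->]] [v Pv [l ->]]; exists (u + v); first exact: PD.
    by exists (m + l)%N; rewrite mulrnDr opprD addrACA.
  + move=> x [u Pu [m xE]] [v Pv [l yE]].
    have uv : u + v = g *+ (m + l).
      apply/eqP; rewrite -subr_eq0 mulrnDr opprD addrACA -xE -yE subrr.
      exact: eqxx.
    have [g0|/eqP ng] := eqVneq g 0.
      move: xE yE; rewrite g0 !mul0rn !subr0 => xE yE.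
      by apply: Pa; [rewrite xE|rewrite yE].
    have [ml|] := posnP (m + l)%N.
      move: xE yE; move/eqP: ml; rewrite addn_eq0 => /andP[/eqP-> /eqP->].
      by rewrite !mulr0n !subr0 => xE yE; apply: Pa; [rewrite xE|rewrite yE].
    move=> ml; case: ng.
    apply: (@mulrn_torsion_free _ _ ((m + l) * n.+1)%N).
      by rewrite muln_gt0 ml.
    apply: Pa.
      by rewrite mulrnA -uv; apply: cone_muln cP _; exact: PD.
    by rewrite mulnC mulrnA -mulNrn; apply: cone_muln cP _.
  + move=> x; rewrite inE => /orP[/eqP->|/Ps[Px|Px]].
    * by right; exists 0 => //; exists 1%N; rewrite sub0r.
    * by left; exists x => //; exists 0%N; rewrite subr0.
    * by right; exists (- x) => //; exists 0%N; rewrite subr0.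
- exists (fun x => exists2 u, P u & exists m, x = u + g *+ m); split.
  + by exists 0 => //; exists 0%N; rewrite mulr0n addr0.
  + move=> x y [u Pu [m ->]] [v Pv [l ->]]; exists (u + v); first exact: PD.
    by exists (m + l)%N; rewrite mulrnDr addrACA.
  + move=> x [u Pu [m xE]] [v Pv [l yE]].
    have uv : u + v = - (g *+ (m + l)).
      apply/eqP; rewrite -subr_eq0 opprK mulrnDr addrACA -xE -yE subrr.
      exact: eqxx.
    case ml: (m + l)%N uv => [|n] uv; last first.
      by case: nP; exists n; rewrite -uv; exact: PD.
    move: xE yE; move/eqP: ml; rewrite addn_eq0 => /andP[/eqP-> /eqP->].
    by rewrite !mulr0n !addr0 => xE yE; apply: Pa; [rewrite xE|rewrite yE].
  + move=> x; rewrite inE => /orP[/eqP->|/Ps[Px|Px]].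
    * by left; exists 0 => //; exists 1%N; rewrite add0r.
    * by left; exists x => //; exists 0%N; rewrite addr0.
    * by right; exists (- x) => //; exists 0%N; rewrite addr0.
Qed.

Definition diffs (s : seq G) : seq G := [seq x - y | x <- s, y <- s].

Lemma cone_max P t (s : seq G) : cone P t -> {subset diffs s <= t} ->
  s != [::] -> exists2 a, a \in s & forall x, x \in s -> P (a - x).
Proof.
move=> [P0 PD Pa Pt] st s0.
have {st}Ps x y : x \in s -> y \in s -> P (x - y) \/ P (y - x).
  by move=> xs ys; rewrite -[y - x]opprB; apply/Pt/st/allpairs_f.
elim: s s0 Ps => [//|g s IH] _ Ps.
have [->|s0] := eqVneq s [::].
  by exists g; rewrite ?inE // => x; rewrite inE => /eqP->; rewrite subrr.
have [|a ain amax] := IH s0.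
  by move=> x y xs ys; apply: Ps; rewrite inE ?xs ?ys orbT.
case: (Ps a g); rewrite ?inE ?ain ?eqxx ?orbT // => Pag.
  exists a; rewrite ?inE ?ain ?orbT // => x; rewrite inE => /orP[/eqP->//|].
  exact: amax.
exists g; rewrite ?inE ?eqxx // => x; rewrite inE => /orP[/eqP->|xs].
  by rewrite subrr.
by rewrite -(subrK a g) -addrA; apply: PD => //; exact: amax.
Qed.

Context (k : fieldType).
Implicit Types p q : group_algebra k G.

Lemma msupp_neq0 p : p != 0 -> msupp p != [::] :> seq G.
Proof.
apply: contra_neq => p0; apply/malgP=> g.
rewrite mcoeff0 mcoeff_outdom //; apply/negP=> gp.
by have : g \in (msupp p : seq G) := gp; rewrite p0.
Qed.

Lemma cone_extremal P t p q : cone P t ->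
  {subset diffs (msupp p) <= t} -> {subset diffs (msupp q) <= t} ->
  p != 0 -> q != 0 -> exists a b, [/\ (p * q)@_(a + b) != 0,
    a \in msupp p, b \in msupp q,
    forall x, x \in msupp p -> P (a - x)
  & forall y, y \in msupp q -> P (b - y)].
Proof.
move=> cP pt qt p0 q0.
have [a ap amax] := cone_max cP pt (msupp_neq0 p0).
have [b bq bmax] := cone_max cP qt (msupp_neq0 q0).
exists a, b; split=> //; have [_ _ Pa _] := cP.
have ext x y : x \in msupp p -> y \in msupp q -> x + y = a + b -> x = a /\ y = b.
  move=> xp yq e.
  have d : b - y = - (a - x).
    by apply/eqP; rewrite -addr_eq0 addrACA -opprD [y + x]addrC e
         [b + a]addrC subrr.
  have /eqP : a - x = 0 by apply: Pa; [exact: amax|rewrite -d; exact: bmax].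
  rewrite subr_eq0 => /eqP ax; split=> //.
  by move: e; rewrite -ax => /addrI.
rewrite mcoeffgM (big_fsetD1 a) //= [X in _ + X]big1_fset ?addr0; last first.
  move=> x; rewrite !inE => /andP[xa xp] _.
  rewrite big1_fset // => y yq _; case: eqP => // /ext[] // xE.
  by rewrite xE eqxx in xa.
rewrite (big_fsetD1 b) //= big1_fset ?addr0; last first.
  move=> y; rewrite !inE => /andP[yb yq] _.
  by case: eqP => // /ext[] // _ yE; rewrite yE eqxx in yb.
by rewrite eqxx mulr1n mulf_neq0 // mcoeff_neq0.
Qed.

Definition gunit : pred (group_algebra k G) := fun p => size (msupp p) == 1%N.

Definition ginv p : group_algebra k G :=
  if gunit p then let g := head 0 (msupp p) in << (p@_g)^-1 *g - g >> else p.

Lemma gunitP p : gunit p -> exists2 g, p = << p@_g *g g >> & p@_g != 0 /\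
  ginv p = << (p@_g)^-1 *g - g >>.
Proof.
rewrite /ginv => up; rewrite up; move: up; rewrite /gunit.
move sE: (msupp p : seq G) => s; case: s sE => [//|g [|//]] sE _.
have gp : msupp p = [fset g] by apply/fsetP=> x; rewrite in_fset1 -(mem_seq1 x g) -sE.
exists g; first by rewrite [LHS]monalgE gp big_seq_fset1.
by split=> //; rewrite mcoeff_neq0 gp fset11.
Qed.

Lemma gmulVr : {in gunit, left_inverse 1 ginv *%R}.
Proof.
move=> p /gunitP[g pE [pg ->]]; rewrite pE [LHS]gmulUU mcoeffUU.
by rewrite mulVf // addNr.
Qed.

Lemma gunitPl p q : q * p = 1 -> gunit p.
Proof.
move=> qp.
have p0 : p != 0.
  by apply: contra_eq_neq qp => ->; rewrite mulr0 eq_sym oner_eq0.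
have q0 : q != 0.
  by apply: contra_eq_neq qp => ->; rewrite mul0r eq_sym oner_eq0.
apply: (@cone_exists (diffs (msupp p) ++ diffs (msupp q))) => -[P cP].
have sp : {subset diffs (msupp p) <= diffs (msupp p) ++ diffs (msupp q)}.
  by move=> x xs; rewrite mem_cat xs.
have sq : {subset diffs (msupp q) <= diffs (msupp p) ++ diffs (msupp q)}.
  by move=> x xs; rewrite mem_cat xs orbT.
have [b [a [ba _ ap bmax amax]]] := cone_extremal cP sq sp q0 p0.
have [b' [a' [ba' bq' ap' _ amin]]] :=
  cone_extremal (cone_opp cP) sq sp q0 p0.
have one0 g : (q * p)@_g != 0 -> g = 0.
  by rewrite qp mcoeffU; case: (eqVneq 0 g) => [->//|]; rewrite eqxx.
have [_ _ Pa _] := cP.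
have d : b - b' = - (a - a').
  by apply/eqP; rewrite -addr_eq0 addrACA -opprD (one0 _ ba) (one0 _ ba') subrr.
have aa' : a = a'.
  apply/eqP; rewrite -subr_eq0; apply/eqP; apply: Pa; first exact: amax.
  by rewrite -d; exact: bmax.
have pa : msupp p = [fset a].
  apply/fsetP=> x; rewrite in_fset1; apply/idP/eqP => [xp|->//].
  apply/esym/eqP; rewrite -subr_eq0; apply/eqP; apply: Pa; first exact: amax.
  by rewrite aa'; exact: amin.
by rewrite /gunit pa cardfs1.
Qed.

Lemma ginv_out : {in [predC gunit], ginv =1 id}.
Proof. by move=> p; rewrite inE /ginv => /negbTE; rewrite /in_mem /= => ->. Qed.

Lemma group_algebra_integral p q : p * q = 0 -> (p == 0) || (q == 0).
Proof.
move=> pq; case: eqVneq => //= p0; case: eqVneq => //= q0.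
apply: (@cone_exists (diffs (msupp p) ++ diffs (msupp q))) => -[P cP].
have sp : {subset diffs (msupp p) <= diffs (msupp p) ++ diffs (msupp q)}.
  by move=> x xs; rewrite mem_cat xs.
have sq : {subset diffs (msupp q) <= diffs (msupp p) ++ diffs (msupp q)}.
  by move=> x xs; rewrite mem_cat xs orbT.
have [a [b []]] := cone_extremal cP sp sq p0 q0.
by rewrite pq mcoeff0 eqxx.
Qed.

HB.instance Definition _ := GRing.ComNzRing_hasMulInverse.Build
  (group_algebra k G) gmulVr gunitPl ginv_out.
HB.instance Definition _ :=
  GRing.ComUnitRing_isIntegral.Build (group_algebra k G) group_algebra_integral.

End Cone.

Definition group_algebra_frac (k : fieldType) (G : torsionFreeZmodType) :
    fieldType :=
  {fraction (group_algebra k G)}.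

Definition field_isomorphic (K L : fieldType) : Prop :=
  exists f : {rmorphism K -> L}, bijective f.

Definition group_isomorphic (G H : zmodType) : Prop :=
  exists f : {additive G -> H}, bijective f.

(* Main.v *)
From HB Require Import structures.
From mathcomp Require Import all_boot all_order all_fingroup all_algebra all_field.
From mathcomp Require Import finmap.
From mathcomp Require Import boolp classical_sets cardinality filter wochoice.
From mathcomp Require Import monalg.
From mathcomp Require Import ring.
Require Import Defs.

Set Implicit Arguments.
Unset Strict Implicit.
Unset Printing Implicit Defensive.
Import Order.TTheory GRing.Theory Num.Theory.
Local Open Scope classical_set_scope.
Local Open Scope ring_scope.

(** Suppose that the fields of G and H are identified, so that a single field L
    of characteristic 0 carries two families of monomials X^g and Y^h, each of
    them a rational basis of a subring with fraction field L. Let N be the set of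
    the g in G for which X^g is a rational multiple of some Y^h. By symmetry N is
    a subgroup of H as well, and the subfield generated by the X^g with g in N
    is also the one generated by the corresponding Y^h. Two facts suffice.

    The groups G/N and H/N are free ([relfree_mod_frame]). Indeed G/N embeds into
    the quotient of the multiplicative group of L by the rational multiples of
    the Y^h, and every subgroup of that quotient is free. If H is finitely
    generated this is unique factorization: the quotient is free on the primes
    of a Laurent polynomial ring. In general a prime may split without end while
    H is exhausted by smaller groups, as 1 - Y^h does when h is divisible, so the
    quotient is only a union of a well-ordered chain, and what has to be free is
    each successive quotient ([relfree_chain]). The chain adjoins the elements of
    H one at a time, keeping the subgroups pure; adjoining one element amounts to
    a tower K(x_0), K(x_1), and so on, where x_n is a constant times a power of
    x_(n+1) ([radical_tower_relfree]). If y^k is a constant times x and K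
    contains the k-th roots of unity, let sigma be the automorphism of K(y)
    sending y to zeta y. The integers v_q(sigma f) - v_q(f), with q ranging over
    the irreducible polynomials, vanish for almost all q, and they all vanish
    exactly when f is, up to a power of y, in K(x). Such a family of
    functionals makes the quotient free, and every subgroup of it
    ([relfree_functionals]). Roots of unity are provided by enlarging the
    constants to an algebraically closed field, which does not enlarge the group
    of the elements of L that are constant multiples of monomials.

    The ranks of G/N and H/N agree ([basis_injection]), both being the
    transcendence degree of L over the subfield generated by N. To include the
    infinite case uniformly, an injection between the bases is extracted from
    the Jacobian matrices of one family of monomials with respect to the other:
    a finite block has a left inverse, hence a nonzero term in a maximal minor,
    hence a partial matching, and the finite supports of the rows allow the
    matchings to be glued by compactness ([infinite_matching]).

    Hence G and H are both isomorphic to the direct sum of N and of free groups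
    of the same rank ([frames_isomorphic]). *)

(** * Well-orders *)

Section WellOrder.
Context (W : eqType) (R : rel W) (woR : well_order R).

Lemma wo_total : total R.
Proof.
by move=> x y; apply: (@wo_chainW _ R predT) => // A _; exact: woR.
Qed.

Lemma wo_anti : antisymmetric R.
Proof.
by move=> x y; apply: (@wo_chain_antisymmetric _ R predT) => // A _; exact: woR.
Qed.

Lemma wo_refl : reflexive R.
Proof. by move=> x; have := wo_total x x; rewrite orbb. Qed.

Lemma wo_min (P : set W) : (exists w, P w) ->
  exists2 w, P w & forall w', P w' -> R w w'.
Proof.
move=> [w0 Pw0]; have [|w [[Pw wmin] _]] := woR (A := fun w => `[<P w>]).
  by exists w0; exact/asboolP.
by exists w => [|w' Pw']; [exact/asboolP|apply/wmin/asboolP].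
Qed.

Lemma wo_ind (P : set W) :
  (forall w, (forall w', R w' w -> w' != w -> P w') -> P w) -> forall w, P w.
Proof.
move=> IH w; apply: contrapT => nPw.
have [w1 nP1 min1] := wo_min (ex_intro (fun w => ~ P w) w nPw).
apply: nP1; apply: IH => w' w'1 w'n1; apply: contrapT => /min1 w1w'.
by move/eqP: w'n1; apply; apply: wo_anti; rewrite w'1.
Qed.

Lemma wo_trans : transitive R.
Proof.
move=> y x z xy yz.
have [w wP wmin] := wo_min (ex_intro (fun w => w = x \/ w = y \/ w = z)
  x (or_introl erefl)).
have wx : R w x by apply: wmin; left.
have wy : R w y by apply: wmin; right; left.
have wz : R w z by apply: wmin; right; right.
case: wP => [wE|[wE|wE]]; move: wx wy wz; rewrite wE // => wx wy wz.
  by rewrite (@wo_anti x y) // xy wx.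
by rewrite (@wo_anti y z) ?yz // in xy *.
Qed.

Lemma wo_max (s : seq W) : s != [::] ->
  exists2 w, w \in s & forall w', w' \in s -> R w' w.
Proof.
elim: s => [//|x s IH] _; have [->|/IH[w ws wmax]] := eqVneq s [::].
  by exists x; rewrite ?mem_head // => w'; rewrite inE => /eqP->; exact: wo_refl.
have [xw|wx] := orP (wo_total x w).
  by exists w; rewrite ?inE ?ws ?orbT // => w' /orP[/eqP->|/wmax].
exists x; rewrite ?mem_head // => w'; rewrite inE => /orP[/eqP->|/wmax w'w].
  exact: wo_refl.
exact: wo_trans wx.
Qed.

End WellOrder.

Lemma leq_well_order : well_order leq.
Proof.
apply: antisymmetric_well_order.
  by move=> m n; rewrite -eqn_leq => /eqP.
move=> A [n An]; have [m Am mmin] := ex_minnP (ex_intro (fun n => n \in A) n An).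
exists m; split=> // p; exact: mmin.
Qed.

(** * Bases of an abelian group modulo a subgroup *)
Section RelativeFreeness.
Context (H : zmodType).
Implicit Types (S T U E : set H) (s : seq H) (m : H -> int).

Definition zsubgroup S := S 0 /\ forall a b, S a -> S b -> S (a - b).

Lemma zsubgroupN S a : zsubgroup S -> S a -> S (- a).
Proof. by case=> S0 SB Sa; rewrite -sub0r; exact: SB. Qed.

Lemma zsubgroupD S a b : zsubgroup S -> S a -> S b -> S (a + b).
Proof.
move=> gS Sa Sb; rewrite -[b]opprK; case: (gS) => _ SB.
by apply: SB => //; exact: zsubgroupN.
Qed.

Lemma zsubgroupMz S a (n : int) : zsubgroup S -> S a -> S (a *~ n).
Proof.
move=> gS Sa; elim/int_rect: n => [|n IH|n IH]; first by rewrite mulr0z; case: gS.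
  by rewrite intS mulrzDr; exact: zsubgroupD.
rewrite -addn1 PoszD opprD mulrzDr [a *~ -1]mulrNz; case: (gS) => _ SB.
exact: SB.
Qed.

Lemma zsubgroup_sum S (I : eqType) (r : seq I) (F : I -> H) :
  zsubgroup S -> (forall i, i \in r -> S (F i)) -> S (\sum_(i <- r) F i).
Proof.
move=> gS SF; rewrite big_seq_cond; apply: (big_ind S).
- by case: gS.
- by move=> *; exact: zsubgroupD.
- by move=> i /andP[/SF].
Qed.

Definition lincomb s m := \sum_(e <- s) e *~ m e.

Definition independent_mod S E := forall s m, uniq s -> (forall e, e \in s -> E e) ->
  S (lincomb s m) -> forall e, e \in s -> m e = 0.

(** Stated by minimality rather than by linear combinations, so that spanning
    passes to unions of chains without any bookkeeping of coefficients. *)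
Definition spans_mod S E T :=
  forall P, zsubgroup P -> S `<=` P -> E `<=` P -> T `<=` P.

Definition basis_mod S E T := [/\ E `<=` T, independent_mod S E & spans_mod S E T].

(** For subgroups S of T this says that T/S is free. The relation is used on the
    preimages, in an arbitrary group, of subgroups of the multiplicative group
    of a field; this is how the freeness of all subgroups of a quotient is
    expressed. *)
Definition relfree S T := exists E, basis_mod S E T.

Lemma relfree_refl S T : T `<=` S -> relfree S T.
Proof.
move=> TS; exists set0; split=> //.
  by move=> s m _ s0 _ e /s0.
by move=> P _ SP _; exact: subset_trans SP.
Qed.

(** The image of phi is a subgroup of the integers; a preimage of its least
    positive element is the basis. *)
Lemma relfree_cyclic S T (phi : H -> int) : zsubgroup T ->
  (forall a b, T a -> T b -> phi (a - b) = phi a - phi b) ->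
  (forall a, S a <-> T a /\ phi a = 0) -> relfree S T.
Proof.
move=> gT phiB SE.
have [allS|/existsNP[a /not_implyP[Ta Sa]]] := pselect (forall a, T a -> S a).
  exact: relfree_refl.
have phi0 : phi 0 = 0 by have [T0 _] := gT; rewrite -[X in phi X](subrr 0) phiB // subrr.
have phiN b : T b -> phi (- b) = - phi b.
  by move=> Tb; have [T0 _] := gT; rewrite -[- b]sub0r phiB // phi0 sub0r.
have phiD b c : T b -> T c -> phi (b + c) = phi b + phi c.
  by move=> Tb Tc; rewrite -[c]opprK phiB ?phiN ?opprK //; exact: zsubgroupN.
have phiM b n : T b -> phi (b *~ n) = phi b * n.
  move=> Tb; elim/int_rect: n => [|n IH|n IH]; first by rewrite mulr0 mulr0z.
    by rewrite intS mulrzDr phiD ?IH ?mulrDr ?mulr1 //; exact: zsubgroupMz.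
  rewrite -addn1 PoszD opprD mulrzDr [b *~ -1]mulrNz phiB ?IH ?mulrDr ?mulrN1 //.
  exact: zsubgroupMz.
pose pos n := `[< exists b, [/\ T b, (0 < n)%N & phi b = n%:Z] >].
have [|d /asboolP[b [Tb d0 phib]] dmin] := @ex_minnP pos.
  have phia : phi a != 0 by apply/eqP=> phia; apply: Sa; apply/SE.
  exists `|phi a|%N; apply/asboolP.
  have [a0|a0] := lerP 0 (phi a).
    by exists a; split=> //; [rewrite absz_gt0|rewrite gez0_abs].
  exists (- a); split; [exact: zsubgroupN|by rewrite absz_gt0|].
  by rewrite phiN // ltz0_abs.
have d0' : d%:Z != 0 by rewrite eqz_nat -lt0n.
exists [set b]; split.
- by move=> _ ->.
- move=> s m us sb /SE[_].
  have [->//|e0] := eqVneq s [::]; have : s = [:: b].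
    case: s us sb e0 => // x [|y s].
      by move=> _ /(_ x (mem_head _ _))->.
    move=> + sb; rewrite (sb x) ?mem_head // (sb y) ?inE ?eqxx ?orbT //=.
    by rewrite inE eqxx.
  move=> ->; rewrite /lincomb big_seq1 phiM // phib => /eqP.
  by rewrite mulf_eq0 (negbTE d0') => /eqP mb e; rewrite inE => /eqP->.
- move=> P gP SP bP c Tc.
  rewrite -(subrK (b *~ (phi c %/ d)%Z) c); apply: zsubgroupD => //; last first.
    by apply: zsubgroupMz => //; exact: bP.
  apply: SP; apply/SE.
  have Tbc : T (c - b *~ (phi c %/ d)%Z).
    by case: (gT) => _ TB; apply: TB => //; exact: zsubgroupMz.
  split=> //; rewrite phiB ?phiM ?phib //; last exact: zsubgroupMz.
  rewrite [d%:Z * _]mulrC {1}(divz_eq (phi c) d) addrAC subrr add0r.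
  have mge0 := modz_ge0 (phi c) d0'; have mlt := ltz_mod (phi c) d0'.
  apply/eqP/contraT => nz.
  have /dmin : pos `|(phi c %% d)%Z|%N.
    apply/asboolP; exists (c - b *~ (phi c %/ d)%Z); split=> //.
      by rewrite absz_gt0.
    rewrite phiB ?phiM ?phib //; last exact: zsubgroupMz.
    by rewrite [d%:Z * _]mulrC {1}(divz_eq (phi c) d) addrAC subrr add0r gez0_abs.
  rewrite leqNgt => /negP; case.
  by rewrite -ltz_nat gez0_abs //; move: mlt; rewrite normr_nat.
Qed.

(** The union of bases of the successive quotients is a basis. In a vanishing
    combination, the terms of maximal index give a relation modulo the earlier
    subgroups, which is excluded; spanning is a well-founded induction. *)
Lemma relfree_chain (W : eqType) (R : rel W) S (T : W -> set H) U :
    well_order R -> zsubgroup S -> (forall w, zsubgroup (T w)) ->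
    (forall w, S `<=` T w) -> (forall w w', R w w' -> T w `<=` T w') ->
    (forall w, relfree
       [set h | S h \/ exists w', [/\ R w' w, w' != w & T w' h]] (T w)) ->
    (forall h, U h <-> S h \/ exists w, T w h) ->
  relfree S U.
Proof.
move=> woR gS gT ST Tmono step UE.
pose below w := [set h | S h \/ exists w', [/\ R w' w, w' != w & T w' h]].
have gbelow w : zsubgroup (below w).
  split; first by left; case: gS.
  have TB w' a b : T w' a -> T w' b -> T w' (a - b) by case: (gT w') => _; apply.
  move=> a b [Sa|[v [vw vnw Ta]]] [Sb|[u [uw unw Tb]]].
  - by left; case: gS => _; apply.
  - by right; exists u; split=> //; apply: TB => //; exact: ST.
  - by right; exists v; split=> //; apply: TB => //; exact: ST.
  - right; have [vu|uv] := orP (wo_total woR v u).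
      by exists u; split=> //; apply: TB => //; exact: Tmono Ta.
    by exists v; split=> //; apply: TB => //; exact: Tmono Tb.
have [E EP] := choice step.
exists (\bigcup_w E w); split.
- move=> e [w _ Ee]; apply/UE; right; exists w.
  by have [ET _ _] := EP w; exact: ET.
- move=> s m us sE Slc e0 e0s; apply: contrapT => /eqP me0.
  have [w0 _ _] := sE _ e0s.
  have [idx idxP] : {f : H -> W & forall e, e \in s -> E (f e) e}.
    apply: (@choice _ _ (fun e w => e \in s -> E w e)) => e.
    by have [/sE[w _ Ee]|] := boolP (e \in s); [exists w|exists w0].
  pose s' := [seq e <- s | m e != 0].
  have e0s' : e0 \in s' by rewrite mem_filter me0.
  have [|w ws wmax] := wo_max woR (s := [seq idx e | e <- s']).
    by case: (s') e0s'.
  have [_ indep _] := EP w.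
  have /mapP[e es' we] := ws.
  suff : m e = 0 by move/eqP; move: es'; rewrite mem_filter => /andP[/negP].
  apply: (indep [seq e <- s' | idx e == w] m).
  + by do 2!apply: filter_uniq.
  + by move=> x; rewrite !mem_filter => /and3P[/eqP<- _ xs]; exact: idxP.
  + have -> : lincomb [seq e <- s' | idx e == w] m =
      lincomb s m - \sum_(e <- s | (m e != 0) && (idx e != w)) e *~ m e.
      apply/eqP; rewrite eq_sym subr_eq /lincomb; apply/eqP.
      rewrite [LHS](bigID (fun e => m e != 0)) /= [X in _ + X]big1 ?addr0; last first.
        by move=> i /negPn/eqP->; rewrite mulr0z.
      rewrite (bigID (fun e => idx e == w)) /= /s' -filter_predI big_filter.
      by congr (_ + _); apply: eq_bigl => i; rewrite /= andbC.
    case: (gbelow w) => b0 bB; apply: (bB); first by left.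
    rewrite -big_filter; apply: zsubgroup_sum => // x.
    rewrite mem_filter => /andP[/andP[mx xw] xs]; apply: zsubgroupMz => //.
    right; exists (idx x); split=> //.
      by apply/wmax/map_f; rewrite mem_filter mx.
    by have [ET _ _] := EP (idx x); apply/ET/idxP.
  + by rewrite mem_filter we eqxx.
- move=> P gP SP EPP h /UE[|[w]]; first exact: SP.
  move: w h; apply: (wo_ind woR) => w IH h Twh.
  have [_ _ sp] := EP w; apply: (sp P) => //.
    by move=> x [/SP//|[w' [w'w w'nw /IH]]]; apply.
  by apply: subset_trans EPP => e Ee; exists w.
Qed.

(** This is the freeness of the subgroups of a free group, T/S being a subgroup of
    the direct sum of copies of the integers indexed by I. Filtering by the
    largest index at which an element is nonzero makes the successive quotients
    cyclic. *)
Lemma relfree_functionals (I : choiceType) (phi : I -> H -> int) S T :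
    zsubgroup T ->
    (forall i a b, T a -> T b -> phi i (a - b) = phi i a - phi i b) ->
    (forall a, T a -> exists s : seq I, forall i, phi i a != 0 -> i \in s) ->
    (forall a, S a <-> T a /\ forall i, phi i a = 0) ->
  relfree S T.
Proof.
move=> gT phiB fin SE; have [T0 TB] := gT.
have phi0 i : phi i 0 = 0 by rewrite -[X in phi _ X](subrr 0) phiB // subrr.
have [R woR] := well_ordering_principle I.
have Rxx := wo_refl woR.
pose Tw i := [set a | T a /\ forall j, phi j a != 0 -> R j i].
apply: (@relfree_chain _ R S Tw) => //.
- split; first by apply/SE.
  move=> a b /SE[Ta a0] /SE[Tb b0]; apply/SE; split; first exact: TB.
  by move=> i; rewrite phiB // a0 b0 subrr.
- move=> i; split; first by split=> // j; rewrite phi0 eqxx.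
  move=> a b [Ta a0] [Tb b0]; split=> [|j]; first exact: TB.
  rewrite phiB //; have [a00|/a0//] := eqVneq (phi j a) 0.
  by rewrite a00 sub0r oppr_eq0 => /b0.
- by move=> i a /SE[Ta a0]; split=> // j; rewrite a0 eqxx.
- move=> i i' ii' a [Ta a0]; split=> // j /a0 ji; exact: (wo_trans woR) ii'.
- move=> i; apply: (@relfree_cyclic _ _ (phi i)).
  + split; first by split=> // j; rewrite phi0 eqxx.
    move=> a b [Ta a0] [Tb b0]; split=> [|j]; first exact: TB.
    rewrite phiB //; have [a00|/a0//] := eqVneq (phi j a) 0.
    by rewrite a00 sub0r oppr_eq0 => /b0.
  + by move=> a b [Ta _] [Tb _]; exact: phiB.
  + move=> a; split.
      move=> [/SE[Ta a0]|[i' [i'i i'ni [Ta a0]]]].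
        by split=> //; split=> // j; rewrite a0 eqxx.
      split; first by split=> // j /a0 ji; exact: (wo_trans woR) i'i.
      apply/eqP/contraT => /a0 ii'; move/eqP: i'ni; case.
      by apply: (wo_anti woR); rewrite i'i.
    move=> [[Ta a0] ia]; have [s sP] := fin _ Ta.
    pose s' := [seq j <- s | phi j a != 0].
    have s'P j : phi j a != 0 -> j \in s' by move=> ja; rewrite mem_filter ja sP.
    have [s0|] := eqVneq s' [::].
      left; apply/SE; split=> // j; apply/eqP/contraT => /s'P.
      by rewrite s0.
    move/(wo_max woR) => [j js jmax]; right; exists j.
    have ja : phi j a != 0 by move: js; rewrite mem_filter => /andP[].
    split; [exact: a0|by apply: contraNneq ja => ->; apply/eqP|].
    by split=> // l /s'P/jmax.
- move=> a; split=> [Ta|[/SE[]//|[i []//]]].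
  have [s sP] := fin _ Ta.
  have [s0|] := eqVneq s [::].
    left; apply/SE; split=> // j; apply/eqP/contraT => /sP.
    by rewrite s0.
  move/(wo_max woR) => [j js jmax]; right; exists j; split=> // l /sP; exact: jmax.
Qed.

End RelativeFreeness.

(** * Multiplicities of irreducible factors *)
Section Multiplicity.
Context (K : fieldType).
Implicit Types (p q r : {poly K}).

Definition monic_irreducible q := q \is monic /\ irreducible_poly q.

Lemma irreducible_dvdpM q p r : irreducible_poly q ->
  (q %| p * r) = (q %| p) || (q %| r).
Proof.
move=> qi; apply/idP/orP => [|[qp|qr]]; last 2 first.
- exact: dvdp_mulr.
- exact: dvdp_mull.
have [qp|qp] := boolP (q %| p); first by left.
by rewrite Gauss_dvdpr ?irreducible_poly_coprime //; right.
Qed.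

Lemma monic_irreducible_divisor p : (1 < size p)%N ->
  exists2 q, monic_irreducible q & q %| p.
Proof.
have [n] := ubnP (size p); elim: n p => // n IH p; rewrite ltnS => pn p1.
have p0 : p != 0 by rewrite -size_poly_gt0 (ltn_trans _ p1).
have [pi|npi] := pselect (irreducible_poly p).
  have lc0 : (lead_coef p)^-1 != 0 by rewrite invr_eq0 lead_coef_eq0.
  exists ((lead_coef p)^-1 *: p); last by rewrite dvdpZl.
  split; first by rewrite monicE lead_coefZ mulVf // lead_coef_eq0.
  split; first by rewrite size_scale.
  move=> d d1; rewrite dvdpZr // => /(apply_irredp pi d1) dp.
  by rewrite (eqp_trans dp) // eqp_sym eqp_scale.
have [d] : exists d : {poly K}, [/\ size d != 1%N, d %| p & ~~ (d %= p)].
  apply: contrapT => nd; apply: npi; split=> // d d1 dp; apply/contraT => ndp.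
  by case: nd; exists d.
move=> [d1 dp ndp]; have d0 : d != 0 by apply: contraTneq dp => ->; rewrite dvd0p.
have [||q qi qd] := IH d.
- apply: leq_trans pn; rewrite ltn_neqAle dvdp_leq // andbT.
  by rewrite dvdp_size_eqp.
- by rewrite ltn_neqAle eq_sym d1 size_poly_gt0.
- by exists q => //; exact: dvdp_trans dp.
Qed.

Definition multp q p : nat := \max_(n < size p | q ^+ n %| p) n.

Lemma dvdp_multp q p n : (1 < size q)%N -> p != 0 ->
  (q ^+ n %| p) = (n <= multp q p)%N.
Proof.
move=> q1 p0; have bound m : q ^+ m %| p -> (m < size p)%N.
  move/(dvdp_leq p0); apply: leq_trans.
  have : (m <= (size (q ^+ m)).-1)%N.
    by rewrite size_exp leq_pmull // -ltnS prednK // ltnW.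
  have : q ^+ m != 0 by rewrite expf_neq0 // -size_poly_gt0 ltnW.
  by rewrite -size_poly_gt0; case: (size _).
apply/idP/idP => [qnp|].
  exact: (@leq_bigmax_cond _ _ (fun i : 'I_(size p) => i : nat)
           (Ordinal (bound _ qnp))).
have -> : multp q p = \max_(i in [pred n : 'I_(size p) | q ^+ n %| p]) val i by [].
have [|i qip ->] := @eq_bigmax_cond _ [pred n : 'I_(size p) | q ^+ n %| p] val.
  apply/card_gt0P; exists (Ordinal (bound 0%N (dvd1p _))).
  by rewrite unfold_in /= expr0 dvd1p.
by move=> ni; apply: dvdp_trans qip; exact: dvdp_exp2l.
Qed.

Lemma multp_gt0 q p : (1 < size q)%N -> p != 0 -> (0 < multp q p)%N = (q %| p).
Proof. by move=> q1 p0; rewrite -(dvdp_multp 1) // expr1. Qed.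

Lemma multpE q p n : (1 < size q)%N -> p != 0 -> ~~ (q %| p) ->
  multp q (q ^+ n * p) = n.
Proof.
move=> q1 p0 nqp; have q0 : q != 0 by rewrite -size_poly_gt0 ltnW.
have np0 : q ^+ n * p != 0 by rewrite mulf_neq0 // expf_neq0.
apply/eqP; rewrite eqn_leq -(dvdp_multp n) // dvdp_mulIl andbT leqNgt.
by rewrite -dvdp_multp // exprSr dvdp_mul2l ?expf_neq0.
Qed.

Lemma multp_factor q p : (1 < size q)%N -> p != 0 ->
  exists2 r, p = q ^+ multp q p * r & ~~ (q %| r).
Proof.
move=> q1 p0; have q0 : q != 0 by rewrite -size_poly_gt0 ltnW.
have : q ^+ multp q p %| p by rewrite dvdp_multp.
move/dvdpP => [r pE]; rewrite mulrC in pE; exists r => //.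
have : ~~ (q ^+ (multp q p).+1 %| p) by rewrite dvdp_multp // ltnn.
by rewrite [X in _ %| X]pE exprSr dvdp_mul2l // expf_neq0.
Qed.

Lemma multpM q p r : irreducible_poly q -> p != 0 -> r != 0 ->
  multp q (p * r) = (multp q p + multp q r)%N.
Proof.
move=> qi p0 r0; have [q1 _] := qi.
have [p' pE np'] := multp_factor q1 p0; have [r' rE nr'] := multp_factor q1 r0.
rewrite {1}pE {1}rE mulrACA -exprD multpE //.
  by apply: contraNneq np' => /eqP; rewrite mulf_eq0 => /orP[/eqP->|/eqP r'0];
    rewrite ?dvdp0 // r'0 dvdp0 in nr' *.
by rewrite irreducible_dvdpM // negb_or np'.
Qed.

Lemma multpC q c : (1 < size q)%N -> c != 0 -> multp q c%:P = 0%N.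
Proof.
move=> q1 c0; apply/eqP; rewrite -leqn0 leqNgt multp_gt0 ?polyC_eq0 //.
apply/negP => /dvdp_leq; rewrite polyC_eq0 size_polyC c0 => /(_ isT).
by rewrite leqNgt q1.
Qed.

Lemma monic_irreducible_eq q r : monic_irreducible q -> monic_irreducible r ->
  q %| r -> q = r.
Proof.
move=> [qm [q1 _]] [rm ri] qr; apply/eqP; rewrite -eqp_monic //.
by apply: apply_irredp => //; rewrite neq_ltn q1 orbT.
Qed.

Lemma irreducible_divisors_finite p : p != 0 ->
  exists s : seq {poly K}, forall q, monic_irreducible q -> q %| p -> q \in s.
Proof.
have [n] := ubnP (size p); elim: n p => // n IH p; rewrite ltnS => pn p0.
have [p1|] := ltnP 1 (size p); last first.
  move=> p1; exists [::] => q [_ [q1 _]] /(dvdp_leq p0) qp.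
  by have := leq_trans q1 (leq_trans qp p1).
have [q qi /dvdpP[r pE]] := monic_irreducible_divisor p1.
have r0 : r != 0 by apply: contraNneq p0 => r0; rewrite pE r0 mul0r.
have q0 : q != 0 by apply: contraNneq p0 => q0; rewrite pE q0 mulr0.
have rn : (size r < n)%N.
  apply: leq_trans pn; rewrite pE size_mul //; case: (qi) => _ [q1 _].
  by case: (size q) q1 => [//|[//|k]] _; rewrite !addnS /= ltnS leq_addr.
have [s sP] := IH r rn r0.
exists (q :: s) => q' q'i; case: (q'i) => _ q'irr.
rewrite pE irreducible_dvdpM // inE => /orP[/(sP _ q'i)->|q'q].
  by rewrite orbT.
by rewrite (monic_irreducible_eq q'i qi) // eqxx.
Qed.

(** Unique factorization, in the form of a statement about multiplicities. *)
Lemma eq_multp p r : p != 0 -> r != 0 ->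
  (forall q, monic_irreducible q -> multp q p = multp q r) ->
  exists2 c, c != 0 & p = c *: r.
Proof.
have [n] := ubnP (size p); elim: n p r => // n IH p r; rewrite ltnS => pn p0 r0 pr.
have [p1|p1] := ltnP 1 (size p); last first.
  have [r1|r1] := ltnP 1 (size r).
    have [q qi qr] := monic_irreducible_divisor r1; have [_ [q1 _]] := qi.
    have := qr; rewrite -multp_gt0 // -pr // multp_gt0 //.
    by move=> /(dvdp_leq p0)/(leq_trans q1)/leq_trans/(_ p1).
  move: p1 r1 p0 r0; move=> /size1_polyC-> /size1_polyC->.
  rewrite !polyC_eq0 => p0 r0; exists (p`_0 / r`_0).
    by rewrite mulf_neq0 // invr_eq0.
  by rewrite -mul_polyC -polyCM divfK.
have [q qi qp] := monic_irreducible_divisor p1; have [_ qirr] := qi.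
have [q1 _] := qirr.
have : q %| r by rewrite -multp_gt0 // -pr // multp_gt0.
move: qp => /dvdpP[p' pE] /dvdpP[r' rE]; subst p r.
move: (p0) (r0); rewrite !mulf_eq0 !negb_or => /andP[p'0 q0] /andP[r'0 _].
have p'n : (size p' < n)%N.
  apply: leq_trans pn; rewrite size_mul //.
  by case: (size q) q1 => [//|[//|k]] _; rewrite !addnS /= ltnS leq_addr.
have [|c c0 ->] := IH p' r' p'n p'0 r'0; last by exists c => //; rewrite scalerAl.
move=> q' q'i; have [_ q'irr] := q'i.
by have := pr _ q'i; rewrite !multpM // => /addIn.
Qed.

End Multiplicity.

(** * The substitution of zeta X for X *)
Section Twist.
Context (K : fieldType).
Implicit Types (p q r : {poly K}) (z c : K).

Definition twist z p := p \Po (z *: 'X).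

Lemma coef_twist z p i : (twist z p)`_i = p`_i * z ^+ i.
Proof.
rewrite /twist comp_polyE coef_sum; have [ip|ip] := ltnP i (size p); last first.
  rewrite nth_default // mul0r big1 // => j _.
  rewrite exprZn !coefZ coefXn; case: eqP => [ij|]; last by rewrite !mulr0.
  by move: (ltn_ord j); rewrite -ij ltnNge ip.
rewrite (bigD1 (Ordinal ip)) //= big1 ?addr0 => [|j ji].
  by rewrite exprZn !coefZ coefXn eqxx mulr1.
rewrite exprZn !coefZ coefXn; case: eqP => [ij|]; last by rewrite !mulr0.
by move/eqP: ji; case; apply: val_inj.
Qed.

Lemma twistM z p q : twist z (p * q) = twist z p * twist z q.
Proof. exact: comp_polyM. Qed.

Lemma twist_eq0 z p : z != 0 -> (twist z p == 0) = (p == 0).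
Proof.
move=> z0; apply/eqP/eqP => [p0|->]; last exact: comp_poly0.
apply/polyP => i; have := coef_twist z p i; rewrite p0 !coef0 => /esym/eqP.
by rewrite mulf_eq0 expf_eq0 (negbTE z0) andbF orbF => /eqP.
Qed.

Lemma twist_twist z1 z2 p : twist z1 (twist z2 p) = twist (z1 * z2) p.
Proof. by apply/polyP => i; rewrite !coef_twist exprMn -mulrA [_ * z1 ^+ i]mulrC. Qed.

Lemma twist_comp_Xn k z c p : k.-primitive_root z ->
  twist z (p \Po (c *: 'X^k)) = p \Po (c *: 'X^k).
Proof.
move=> zk; rewrite /twist -comp_polyA comp_polyZ comp_Xn_poly exprZn scalerA.
by rewrite (prim_expr_order zk) mulr1.
Qed.

(** The substitution multiplies the coefficient of degree i by z^i, so all degrees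
    present in an eigenvector are congruent modulo k. *)
Lemma twist_eigen k z c p : k.-primitive_root z -> p != 0 ->
  twist z p = c *: p -> exists i r, p = 'X^i * (r \Po 'X^k).
Proof.
move=> zk p0 tp; have k0 := prim_order_gt0 zk.
have czi i : p`_i != 0 -> c = z ^+ i.
  by move=> pi; apply: (mulIf pi); rewrite [RHS]mulrC -coef_twist tp coefZ.
pose l := (size p).-1; have pl : p`_l != 0 by rewrite -/(lead_coef p) lead_coef_eq0.
exists (l %% k)%N, (\poly_(i < size p) p`_(l %% k + i * k)).
apply/polyP => i; rewrite coefXnM coef_comp_poly_Xn //.
have [pi|pi] := eqVneq p`_i 0; last first.
  have il : (i = l %[mod k])%N.
    by apply/eqP; rewrite -(eq_prim_root_expr zk) -(czi _ pi) -(czi _ pl).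
  have -> : (i < l %% k)%N = false by rewrite -il ltnNge leq_mod.
  have -> : (i - l %% k = i %/ k * k)%N by rewrite -il {1}(divn_eq i k) addnK.
  rewrite dvdn_mull // mulnK // coef_poly -il addnC -divn_eq.
  case: ltnP => // ik; move/eqP: pi; case.
  by rewrite nth_default // (leq_trans ik) // leq_div.
rewrite pi; case: ltnP => // il; case: ifP => // /dvdnP[m im].
by rewrite coef_poly; case: ifP => // _; rewrite im mulnK // -im subnKC.
Qed.

(** The product of the conjugates of p; it serves to make denominators
    invariant. *)
Lemma twist_norm k z p : k.-primitive_root z -> p != 0 ->
  exists2 r, r != 0 & twist z (p * r) = p * r.
Proof.
move=> zk p0; have k0 := prim_order_gt0 zk.
have z0 : z != 0.
  apply/eqP => z0; have := prim_expr_order zk.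
  by move/eqP; rewrite z0 expr0n gtn_eqF // eq_sym oner_eq0.
exists (\prod_(i < k.-1) twist (z ^+ i.+1) p).
  by apply/prodf_neq0 => i _; rewrite twist_eq0 // expf_neq0.
have tprod (F : nat -> {poly K}) n :
    twist z (\prod_(i < n) F i) = \prod_(i < n) twist z (F i).
  elim: n => [|n IH]; first by rewrite !big_ord0 /twist comp_polyC.
  by rewrite !big_ord_recr /= twistM IH.
have tz1 : twist (z ^+ 0) p = p.
  by apply/polyP => i; rewrite coef_twist expr0 expr1n mulr1.
transitivity (\prod_(i < k) twist (z ^+ i.+1) p).
  rewrite -{1}tz1; have -> : twist (z ^+ 0) p * \prod_(i < k.-1) twist (z ^+ i.+1) p
      = \prod_(i < k.-1.+1) twist (z ^+ i) p by rewrite big_ord_recl.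
  rewrite (tprod (fun i => twist (z ^+ i) p)) prednK //.
  by apply: eq_bigr => i _; rewrite twist_twist -exprS.
rewrite -[in LHS](prednK k0) big_ord_recr /= prednK // (prim_expr_order zk).
by rewrite mulrC -[1]/(z ^+ 0) tz1.
Qed.

End Twist.

(** * Towers of radical extensions *)
Section RadicalTower.
Context (K L : fieldType) (j : {rmorphism K -> L}) (M : set L) (x : nat -> L).
Context (H : zmodType) (Y : H -> L).
Implicit Types (P Q : {poly K}) (n : nat).

Local Notation ev n P := ((map_poly j P).[x n]).

Hypothesis M1 : M 1.
Hypothesis MM : forall u v, M u -> M v -> M (u * v).
Hypothesis MV : forall u, M u -> M u^-1.
Hypothesis M_neq0 : forall u, M u -> u != 0.
Hypothesis Mx : forall n, M (x n).
Hypothesis x_transcendental : forall n P, ev n P = 0 -> P = 0.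
Hypothesis x_radical : forall n, exists (c : K) (k : nat) (z : K),
  [/\ c != 0, (0 < k)%N, k.-primitive_root z & x n = j c * x n.+1 ^+ k].
Hypothesis M_monomial : forall n v P Q, M v -> P != 0 -> v * ev n P = ev n Q ->
  exists (c : K) a b, c != 0 /\ v * x n ^+ a = j c * x n ^+ b.
Hypothesis YB : forall a b, Y (a - b) = Y a / Y b.
Hypothesis Y_neq0 : forall a, Y a != 0.

Let x_neq0 n : x n != 0. Proof. exact: M_neq0. Qed.

Let ev_eq0 n P : (ev n P == 0) = (P == 0).
Proof. by apply/eqP/eqP => [/x_transcendental//|->]; rewrite rmorph0 horner0. Qed.

Let evM n P Q : ev n (P * Q) = ev n P * ev n Q.
Proof. by rewrite rmorphM hornerM. Qed.

Let evXn n a : ev n 'X^a = x n ^+ a.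
Proof. by rewrite map_polyXn hornerXn. Qed.

Let evC n c : ev n c%:P = j c.
Proof. by rewrite map_polyC hornerC. Qed.

Let evZ n c P : ev n (c *: P) = j c * ev n P.
Proof. by rewrite -mul_polyC evM evC. Qed.

Let ev_comp n P Q : ev n (P \Po Q) = (map_poly j P).[ev n Q].
Proof. by rewrite map_comp_poly horner_comp. Qed.

Let MX u n : M u -> M (u ^+ n).
Proof. by move=> Mu; elim: n => [|n IH]; rewrite ?expr0 // exprS; exact: MM. Qed.

Definition represents n h v P Q :=
  [/\ M v, P != 0, Q != 0 & Y h * ev n Q = v * ev n P].

(** The preimage under [Y] of the subgroup generated by M, the group of monomials
    of the ambient field, and the nonzero elements of K(x_n). *)
Definition level n h := exists v P Q, represents n h v P Q.

Definition ground h := exists v c, [/\ M v, c != 0 & Y h = v * j c].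

Let Y00 : Y 0 = 1.
Proof. by rewrite -(subrr 0) YB divff. Qed.

Let representsE n h v P Q : represents n h v P Q -> Y h = v * ev n P / ev n Q.
Proof. by move=> [_ _ Q0 <-]; rewrite mulfK // ev_eq0. Qed.

Let representsB n a b v P Q v' P' Q' : represents n a v P Q ->
  represents n b v' P' Q' -> represents n (a - b) (v / v') (P * Q') (Q * P').
Proof.
move=> r r'; have [Mv P0 Q0 e] := r; have [Mv' P'0 Q'0 e'] := r'.
split; rewrite ?mulf_neq0 //.
  by apply: MM => //; exact: MV.
rewrite YB !evM (representsE r) (representsE r').
have := (P'0, Q0, Q'0); rewrite -!(ev_eq0 n) => -[[P'e Qe] Q'e].
have v'0 := M_neq0 Mv'; have v0 := M_neq0 Mv; field; exact/and4P.
Qed.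

Lemma level_zsubgroup n : zsubgroup (level n).
Proof.
split.
  exists 1, 1, 1; split; rewrite ?oner_eq0 //.
  by rewrite Y00.
move=> a b [v [P [Q r]]] [v' [P' [Q' r']]].
by exists (v / v'), (P * Q'), (Q * P'); exact: representsB.
Qed.

Lemma ground_zsubgroup : zsubgroup ground.
Proof.
split; first by exists 1, 1; split; rewrite ?oner_eq0 // rmorph1 Y00 mulr1.
move=> a b [v [c [Mv c0 e]]] [v' [c' [Mv' c'0 e']]]; exists (v / v'), (c / c').
split; first by apply: MM => //; exact: MV.
  by rewrite mulf_neq0 // invr_eq0.
by rewrite YB e e' fmorph_div invfM mulrACA.
Qed.

Lemma ground_level n : ground `<=` level n.
Proof.
move=> h [v [c [Mv c0 e]]]; exists v, c%:P, 1; split=> //.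
- by rewrite polyC_eq0.
- exact: oner_neq0.
- by rewrite e evC rmorph1 hornerC mulr1.
Qed.

(** An element of the subgroup generated by M and K(x_n) has many representations
    v P(x_n)/Q(x_n). Functionals on polynomials that are additive and vanish on
    constants and on 'X are insensitive to the choice, because M meets
    K(x_n) only in constants times powers of x_n. *)
Lemma level_relfree n (I : choiceType) (psi : I -> {poly K} -> int) S :
    (forall i P Q, P != 0 -> Q != 0 -> psi i (P * Q) = psi i P + psi i Q) ->
    (forall i c, c != 0 -> psi i c%:P = 0) -> (forall i, psi i 'X = 0) ->
    (forall P, P != 0 ->
       exists s : seq I, forall i, psi i P != 0 -> i \in s) ->
    (forall h, S h <-> exists v P Q, represents n h v P Q /\
                                     forall i, psi i P = psi i Q) ->
  relfree S (level n).
Proof.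
move=> psiM psiC psiX fin SE.
have psiXn i a : psi i 'X^a = 0.
  elim: a => [|a IH]; first by rewrite expr0 psiC ?oner_eq0.
  by rewrite exprS psiM ?psiX ?IH // ?expf_neq0 // polyX_eq0.
have uniq_psi h v P Q v' P' Q' i : represents n h v P Q ->
    represents n h v' P' Q' -> psi i P - psi i Q = psi i P' - psi i Q'.
  move=> r r'; have [Mv P0 Q0 _] := r; have [Mv' P'0 Q'0 _] := r'.
  have e2 : (v / v') * ev n (P * Q') = ev n (P' * Q).
    have := etrans (esym (representsE r)) (representsE r').
    have := (Q0, Q'0); rewrite -!(ev_eq0 n) => -[Qe Q'e].
    have v'0 := M_neq0 Mv'; rewrite !evM => e.
    have -> : v / v' * (ev n P * ev n Q') = v * ev n P / ev n Q / v' * (ev n Q * ev n Q').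
      by field; exact/andP.
    by rewrite e; field; exact/andP.
  have [||c [a [b [c0 vab]]]] := M_monomial _ _ e2; rewrite ?mulf_neq0 //.
    by apply: MM => //; exact: MV.
  have : c%:P * 'X^b * (P * Q') = 'X^a * (P' * Q).
    apply/eqP; rewrite -subr_eq0 -(ev_eq0 n) rmorphB hornerD hornerN subr_eq0.
    rewrite (evM n (c%:P * 'X^b)) (evM n 'X^a) (evM n c%:P) evC !evXn -vab -e2.
    by apply/eqP; ring.
  move/(congr1 (psi i)); rewrite !psiM ?mulf_neq0 ?expf_neq0 ?polyX_eq0 ?polyC_eq0 //.
  rewrite psiC // !psiXn !add0r => e3.
  by apply/eqP; rewrite subr_eq addrAC eq_sym subr_eq e3.
have [w wP] : {f : H -> L * {poly K} * {poly K} &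
    forall h, level n h -> represents n h (f h).1.1 (f h).1.2 (f h).2}.
  apply: (@choice _ _ (fun h f => level n h -> represents n h f.1.1 f.1.2 f.2)).
  move=> h; have [[v [P [Q r]]]|nl] := pselect (level n h).
    by exists (v, P, Q).
  by exists (0, 0, 0).
pose phi i h := psi i (w h).1.2 - psi i (w h).2.
have phiE i h v P Q : represents n h v P Q -> phi i h = psi i P - psi i Q.
  move=> r; have /wP r' : level n h by exists v, P, Q.
  exact: uniq_psi r' r.
apply: (@relfree_functionals _ _ phi).
- exact: level_zsubgroup.
- move=> i a b /wP ra /wP rb; have [_ Pa0 Qa0 _] := ra; have [_ Pb0 Qb0 _] := rb.
  rewrite (phiE _ _ _ _ _ (representsB ra rb)) !psiM // /phi.
  by rewrite [in LHS]opprD opprB addrACA.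
- move=> h lh; have /wP [_ P0 Q0 _] := lh.
  have [s sP] := fin _ P0; have [t tP] := fin _ Q0; exists (s ++ t) => i.
  rewrite mem_cat /phi; apply: contraR; rewrite negb_or => /andP[ns nt].
  rewrite subr_eq0; apply/eqP; transitivity (0 : int).
    by apply/eqP; apply: contraNT ns => /sP.
  by apply/esym/eqP; apply: contraNT nt => /tP.
- move=> h; split.
    move=> /SE[v [P [Q [r e]]]]; split; first by exists v, P, Q.
    by move=> i; rewrite (phiE _ _ _ _ _ r) e subrr.
  move=> [lh ph]; apply/SE; exists (w h).1.1, (w h).1.2, (w h).2.
  by split=> [|i]; [exact: wP|apply/eqP; rewrite -subr_eq0; apply/eqP/ph].
Qed.

Let represents_succ n h v P Q c k : x n = j c * x n.+1 ^+ k ->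
  represents n h v P Q ->
  represents n.+1 h v (P \Po (c *: 'X^k)) (Q \Po (c *: 'X^k)).
Proof.
move=> xn [Mv P0 Q0 e].
have evR R : ev n.+1 (R \Po (c *: 'X^k)) = ev n R.
  by rewrite ev_comp evZ evXn -xn.
by split; rewrite ?evR // -(ev_eq0 n.+1) evR ev_eq0.
Qed.

Lemma level_mono n : level n `<=` level n.+1.
Proof.
move=> h [v [P [Q r]]]; have [c [k [z [_ _ _ xn]]]] := x_radical n.
by exists v, (P \Po (c *: 'X^k)), (Q \Po (c *: 'X^k)); exact: represents_succ.
Qed.

(** Unique factorization in K['X], the irreducible polynomial 'X being discarded
    since it is a monomial. *)
Lemma level0_relfree : relfree ground (level 0).
Proof.
pose psi q P : int :=
  if `[<monic_irreducible q /\ q <> 'X>] then (multp q P)%:Z else 0.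
have irrX : monic_irreducible ('X : {poly K}).
  by split; [exact: monicX|rewrite -['X]subr0; exact: irredp_XsubC].
apply: (@level_relfree 0 _ psi).
- move=> q P Q P0 Q0; rewrite /psi; case: asboolP => // -[[_ qi] _].
  by rewrite multpM // PoszD.
- move=> q c c0; rewrite /psi; case: asboolP => // -[[_ [q1 _]] _].
  by rewrite multpC.
- move=> q; rewrite /psi; case: asboolP => // -[qi qX]; have [_ [q1 _]] := qi.
  apply/eqP; rewrite eqz_nat -leqn0 leqNgt multp_gt0 ?polyX_eq0 //.
  by apply/negP => /(monic_irreducible_eq qi irrX).
- move=> P P0; have [s sP] := irreducible_divisors_finite P0; exists s => q.
  rewrite /psi; case: asboolP => [[qi qX]|]; last by rewrite eqxx.
  have [_ [q1 _]] := qi.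
  by rewrite eqz_nat -lt0n multp_gt0 // => /(sP _ qi).
- move=> h; split.
    move=> [v [c [Mv c0 e]]]; exists v, c%:P, 1; split.
      by split; rewrite ?polyC_eq0 ?oner_neq0 // evC rmorph1 hornerC mulr1.
    move=> q; rewrite /psi; case: asboolP => // -[[_ [q1 _]] _].
    by rewrite !multpC ?oner_neq0.
  move=> [v [P [Q [r e]]]]; have [Mv P0 Q0 _] := r.
  have [X1 _] := irrX.2.
  pose P' := 'X^(multp 'X Q) * P; pose Q' := 'X^(multp 'X P) * Q.
  have X0 a : ('X^a : {poly K}) != 0 by rewrite expf_neq0 // polyX_eq0.
  have [||q qi|c c0] := @eq_multp _ P' Q'; rewrite ?mulf_neq0 //.
    have [_ qirr] := qi; have [q1 _] := qirr; rewrite !multpM //.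
    have [->|/eqP qX] := eqVneq q 'X.
      have mX a : multp 'X ('X^a : {poly K}) = a.
        rewrite -['X^a]mulr1 multpE ?oner_neq0 //.
        by apply/negP => /(dvdp_leq (oner_neq0 _)); rewrite size_poly1 leqNgt X1.
      by rewrite !mX addnC.
    have qXn a : multp q 'X^a = 0%N.
      apply/eqP; rewrite -leqn0 leqNgt multp_gt0 //; apply/negP.
      elim: a => [|a IH].
        by move/(dvdp_leq (oner_neq0 _)); rewrite size_poly1 leqNgt q1.
      by rewrite exprS irreducible_dvdpM // => /orP[/(monic_irreducible_eq qi irrX)|].
    rewrite !qXn !add0n; have := e q; rewrite /psi; case: asboolP => [_ []//|[]//].
  move/(congr1 (fun R => ev 0 R)); rewrite evZ !evM !evXn => e'.
  exists (v * (x 0 ^+ multp 'X P / x 0 ^+ multp 'X Q)), c; split=> //.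
    by apply: MM => //; apply: MM; [|apply: MV]; exact: MX.
  rewrite (representsE r).
  have := Q0; rewrite -(ev_eq0 0) => Qe.
  have xe a : x 0 ^+ a != 0 by exact: expf_neq0.
  have -> : ev 0 P = j c * (x 0 ^+ multp 'X P * ev 0 Q) / x 0 ^+ multp 'X Q.
    by rewrite -e' mulrC mulKf.
  move: (xe (multp 'X Q)); move: (x 0 ^+ _) (x 0 ^+ _) => u w u0.
  by field; exact/andP.
Qed.

(** The functionals compare the multiplicities of q in the twist of a polynomial
    and in the polynomial itself. If they agree on P and Q, then P/Q is, up to a
    constant, invariant under the twist; multiplying P and Q by the other
    conjugates of Q turns both into eigenvectors of the twist. *)
Lemma level_step_relfree n : relfree (level n) (level n.+1).
Proof.
have [c [k [z [c0 k0 zk xn]]]] := x_radical n.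
have z0 : z != 0.
  apply/eqP => z0; have := prim_expr_order zk.
  by move/eqP; rewrite z0 expr0n gtn_eqF // eq_sym oner_eq0.
pose psi q P : int := if `[<monic_irreducible q>] then
  (multp q (twist z P))%:Z - (multp q P)%:Z else 0.
have tC a : twist z a%:P = a%:P by rewrite /twist comp_polyC.
apply: (@level_relfree n.+1 _ psi).
- move=> q P Q P0 Q0; rewrite /psi; case: asboolP => // -[_ qi].
  by rewrite twistM !multpM ?twist_eq0 // !PoszD opprD addrACA.
- move=> q a a0; rewrite /psi; case: asboolP => // -[_ [q1 _]].
  by rewrite tC subrr.
- move=> q; rewrite /psi; case: asboolP => // -[_ qi]; have [q1 _] := qi.
  rewrite /twist comp_polyX -mul_polyC multpM ?polyX_eq0 ?polyC_eq0 //.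
  by rewrite multpC // add0n subrr.
- move=> P P0; have tP0 : twist z P != 0 by rewrite twist_eq0.
  have [s sP] := irreducible_divisors_finite P0.
  have [t tP] := irreducible_divisors_finite tP0; exists (s ++ t) => q.
  rewrite /psi; case: asboolP => [qi|]; last by rewrite eqxx.
  have [_ [q1 _]] := qi; rewrite mem_cat.
  apply: contraR; rewrite negb_or => /andP[ns nt].
  have m0 R (l : seq {poly K}) : R != 0 -> q \notin l ->
      (q %| R -> q \in l) -> multp q R = 0%N.
    move=> R0 nl Rl; apply/eqP; rewrite -leqn0 leqNgt multp_gt0 //.
    by apply: contra nl => /Rl.
  by rewrite (m0 _ _ P0 ns (sP q qi)) (m0 _ _ tP0 nt (tP q qi)) subrr.
- move=> h; split.
    move=> [v [P [Q r]]]; exists v, (P \Po (c *: 'X^k)), (Q \Po (c *: 'X^k)).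
    split; first exact: represents_succ.
    by move=> q; rewrite /psi !(twist_comp_Xn _ _ zk) !subrr.
  move=> [v [P [Q [r e]]]]; have [Mv P0 Q0 _] := r.
  have [||q qi|d d0 e1] := @eq_multp _ (twist z P * Q) (P * twist z Q).
  - by rewrite mulf_neq0 // twist_eq0.
  - by rewrite mulf_neq0 // twist_eq0.
  - have [_ qirr] := qi; rewrite !multpM ?twist_eq0 //.
    have := e q; rewrite /psi; case: asboolP => [_|/(_ qi)//] /eqP.
    by rewrite subr_eq addrAC eq_sym subr_eq -!PoszD eqz_nat addnC => /eqP->; rewrite addnC.
  have [N1 N10 tN] := twist_norm zk Q0.
  have [a [R' NE]] := twist_eigen zk (mulf_neq0 Q0 N10) (etrans tN (esym (scale1r _))).
  have tA : twist z (P * N1) = d *: (P * N1).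
    apply: (mulIf Q0); rewrite twistM mulrAC e1 -scalerAl -mulrA -twistM tN.
    by rewrite -scalerAl mulrA mulrAC.
  have [b [R AE]] := twist_eigen zk (mulf_neq0 P0 N10) tA.
  have evR B : ev n.+1 (B \Po 'X^k) = ev n (B \Po (c^-1 *: 'X)).
    rewrite !ev_comp evXn evZ; congr (_.[_]).
    by rewrite map_polyX hornerX xn mulrA -rmorphM mulVf // rmorph1 mul1r.
  exists (v * (x n.+1 ^+ b / x n.+1 ^+ a)), (R \Po (c^-1 *: 'X)), (R' \Po (c^-1 *: 'X)).
  have nz B l : 'X^l * (B \Po 'X^k) != 0 -> B \Po (c^-1 *: 'X) != 0.
    rewrite mulf_eq0 negb_or => /andP[_].
    by rewrite -(ev_eq0 n.+1) evR ev_eq0.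
  split.
  - by apply: MM => //; apply: MM; [|apply: MV]; exact: MX.
  - by apply: (nz _ b); rewrite -AE mulf_neq0.
  - by apply: (nz _ a); rewrite -NE mulf_neq0.
  have xe l : x n.+1 ^+ l != 0 by exact: expf_neq0.
  have := congr1 (fun B => ev n.+1 B) NE; have := congr1 (fun B => ev n.+1 B) AE.
  rewrite /= !evM !evXn !evR => AE' NE'.
  have Qe : ev n.+1 Q != 0 by rewrite ev_eq0.
  have N1e : ev n.+1 N1 != 0 by rewrite ev_eq0.
  have -> : ev n (R' \Po (c^-1 *: 'X)) = ev n.+1 Q * ev n.+1 N1 / x n.+1 ^+ a.
    by rewrite NE' mulrC mulKf.
  have -> : ev n (R \Po (c^-1 *: 'X)) = ev n.+1 P * ev n.+1 N1 / x n.+1 ^+ b.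
    by rewrite AE' mulrC mulKf.
  rewrite (representsE r).
  move: (xe a) (xe b) Qe; move: (x n.+1 ^+ a) (x n.+1 ^+ b) => u w u0 w0 Qe.
  by field; exact/and3P.
Qed.

Theorem radical_tower_relfree : relfree ground (\bigcup_n level n).
Proof.
apply: (@relfree_chain _ nat leq _ level _ leq_well_order).
- exact: ground_zsubgroup.
- exact: level_zsubgroup.
- exact: ground_level.
- move=> n m /subnK <-; elim: (m - n)%N => // l IH h /IH.
  exact: level_mono.
- move=> [|n].
    have -> : [set h | ground h \/
        exists w', [/\ (w' <= 0)%N, w' != 0%N & level w' h]] = ground.
      apply/seteqP; split=> h /=; last by left.
      by move=> [//|[[|w] []]].
    exact: level0_relfree.
  have -> : [set h | ground h \/
      exists w', [/\ (w' <= n.+1)%N, w' != n.+1 & level w' h]] = level n.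
    apply/seteqP; split=> h /=.
      move=> [|[w [wn wnn]]]; first exact: ground_level.
      have : (w <= n)%N by rewrite -ltnS ltn_neqAle wnn.
      move/subnK <-; elim: (n - w)%N => // l IH lw; apply: level_mono; exact: IH.
    by right; exists n; rewrite leqnSn neq_ltn ltnSn.
  exact: level_step_relfree.
- move=> h; split=> [[n _ lh]|[/(@ground_level 0) lh|[n lh]]].
  + by right; exists n.
  + by exists 0%N.
  + by exists n.
Qed.

End RadicalTower.

(** * Fraction fields and group algebras *)

(** The fraction field is characterized rather than constructed, because the
    field of H is used as a fraction field of the group algebra of G, along an
    isomorphism. *)
Definition fraction_field_of (R : idomainType) (F : fieldType) (f : R -> F) :=
  injective f /\ forall u, exists a b, b != 0 /\ u = f a / f b.

Lemma tofrac_fraction_field (R : idomainType) : fraction_field_of (@tofrac R).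
Proof.
split=> [a b /eqP|u]; first by rewrite tofrac_eq => /eqP.
elim/quotW: u => u; exists \n_u, \d_u; split; first exact: denom_ratioP.
have d0 : tofrac \d_u != 0 by rewrite tofrac_eq0 denom_ratioP.
apply: (mulIf d0); rewrite divfK //.
unlock tofrac; rewrite -[LHS]FracField.pi_mul; apply/eqmodP.
rewrite /= FracField.equivfE /FracField.mulf.
rewrite !numden_Ratio ?mulf_neq0 ?oner_neq0 ?denom_ratioP //.
by rewrite !mulr1 mulrC.
Qed.

Lemma fraction_lift (R : idomainType) (E F : fieldType) (iota : {rmorphism R -> E})
    (f : {rmorphism R -> F}) : fraction_field_of iota -> injective f ->
  exists g : {rmorphism E -> F}, forall a, g (iota a) = f a.
Proof.
move=> [iota_inj iota_frac] finj.
have f0 a : (f a == 0) = (a == 0) by rewrite -(inj_eq finj) rmorph0.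
have i0 a : (iota a == 0) = (a == 0) by rewrite -(inj_eq iota_inj) rmorph0.
have [r rP] : {r : E -> R * R & forall u, (r u).2 != 0 /\
    u = iota (r u).1 / iota (r u).2}.
  apply: (@choice _ _ (fun u r => r.2 != 0 /\ u = iota r.1 / iota r.2)) => u.
  by have [a [b h]] := iota_frac u; exists (a, b).
pose g u := f (r u).1 / f (r u).2.
have gE (a b : R) : b != 0 -> g (iota a / iota b) = f a / f b.
  move=> b0; have := rP (iota a / iota b); rewrite /g.
  move: (r _).1 (r _).2 => c d [d0 /eqP].
  rewrite eqr_div ?i0 // -!rmorphM (inj_eq iota_inj) => /eqP e.
  by apply/eqP; rewrite eqr_div ?f0 // -!rmorphM e.
have gB : zmod_morphism g.
  move=> u v; have [c0 uE] := rP u; have [d0 vE] := rP v.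
  rewrite [in LHS]uE [in LHS]vE -mulNr addf_div ?i0 //.
  rewrite -rmorphN -!(rmorphM iota) -(rmorphD iota) gE ?mulf_neq0 //.
  by rewrite rmorphD !rmorphM rmorphN /g -[in RHS]mulNr [RHS]addf_div ?f0.
have gM : monoid_morphism g.
  split; first by rewrite -[1](divr1 1) -(rmorph1 iota) gE ?oner_eq0 // rmorph1 divr1.
  move=> u v; have [c0 uE] := rP u; have [d0 vE] := rP v.
  rewrite [in LHS]uE [in LHS]vE mulf_div -!(rmorphM iota) gE ?mulf_neq0 //.
  by rewrite !rmorphM /g mulf_div.
pose gA := GRing.isZmodMorphism.Build _ _ g gB.
pose gMm := GRing.isMonoidMorphism.Build _ _ g gM.
pose g' : {rmorphism E -> F} := HB.pack g gA gMm.
exists g' => a.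
by rewrite /= -[iota a]divr1 -(rmorph1 iota) gE ?oner_eq0 // rmorph1 divr1.
Qed.

Section Extension.
Context (k : fieldType) (G : zmodType) (A : comNzRingType).
Context (j : {rmorphism k -> A}) (chi : G -> A).
Hypothesis chi0 : chi 0 = 1.
Hypothesis chiD : forall a b, chi (a + b) = chi a * chi b.

Lemma group_algebra_universal :
  exists f : {rmorphism group_algebra k G -> A},
    forall p, f p = \sum_(g <- msupp p) j p@_g * chi g.
Proof.
pose f (p : group_algebra k G) : A := mmap j chi p.
have fU c g : f << c *g g >> = j c * chi g by exact: mmapU.
have fB : zmod_morphism f by exact: raddfB.
pose fA := GRing.isZmodMorphism.Build _ _ f fB.
pose f1 : {additive group_algebra k G -> A} := HB.pack f fA.
have fM : monoid_morphism f.
  split; first by rewrite -[1]/(<< 1 *g 0 >>) fU rmorph1 mul1r chi0.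
  move=> p q; rewrite [p * q]/(gmul p q).
  have fsum (s : seq G) F : f (\sum_(g <- s) F g) = \sum_(g <- s) f (F g).
    exact: (raddf_sum f1).
  rewrite fsum [in RHS](monalgE p) [in RHS](monalgE q) !fsum.
  rewrite mulr_suml; apply: eq_bigr => g _.
  rewrite fsum mulr_sumr; apply: eq_bigr => h _.
  by rewrite !fU rmorphM chiD mulrACA.
pose fMm := GRing.isMonoidMorphism.Build _ _ f fM.
pose f2 : {rmorphism group_algebra k G -> A} := HB.pack f fA fMm.
by exists f2 => p.
Qed.

End Extension.

Lemma group_algebra_map (k k' : fieldType) (G G' : zmodType)
    (tau : {rmorphism k -> k'}) (phi : {additive G -> G'}) : injective phi ->
  exists f : {rmorphism group_algebra k G -> group_algebra k' G'},
    [/\ injective f, forall c, f c%:A = (tau c)%:A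
      , forall g, f (gmonom k g) = gmonom k' (phi g)
      & forall p g, (f p)@_(phi g) = tau p@_g].
Proof.
move=> phi_inj.
have [||f fE] := @group_algebra_universal k G _
  (in_alg _ \o tau : {rmorphism k -> group_algebra k' G'})
  (fun g => gmonom k' (phi g)).
- by rewrite raddf0.
- by move=> a b; rewrite raddfD gmonomD.
have fcoef p g : (f p)@_(phi g) = tau p@_g.
  rewrite fE raddf_sum /=.
  have termE h : ((tau p@_h)%:A * gmonom k' (phi h) : group_algebra k' G')@_(phi g)
      = tau p@_h *+ (h == g).
    by rewrite -scalerAl mul1r mcoeffZ mcoeffU (inj_eq phi_inj) mulrnAr mulr1.
  under eq_bigr do rewrite termE.
  have [gp|gp] := boolP (g \in msupp p).
    rewrite (big_fsetD1 _ gp) /= eqxx big_seq big1 ?addr0 // => h.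
    by rewrite !inE => /andP[/negbTE-> _].
  rewrite (mcoeff_outdom gp) rmorph0 big_seq big1 // => h hp.
  by case: eqP => // hg; rewrite -hg hp in gp.
have fU c g : f << c *g g >> = (tau c)%:A * gmonom k' (phi g).
  rewrite fE; have [->|c0] := eqVneq c 0.
    by rewrite monalgU0 msupp0 big_seq_fset0 rmorph0 scale0r mul0r.
  by rewrite msuppU (negbTE c0) big_seq_fset1 mcoeffUU.
exists f; split=> //.
- move=> p q pq; apply/malgP => g; apply: (fmorph_inj tau).
  by rewrite -!fcoef pq.
- move=> c; have -> : c%:A = << c *g 0 >> :> group_algebra k G.
    by apply/malgP => h; rewrite mcoeffZ !mcoeffU mulrnAr mulr1.
  by rewrite fU raddf0 mulr1.
- by move=> g; rewrite fU rmorph1 scale1r mul1r.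
Qed.

(** * Rational functions supported on a subgroup *)
Section RationalFunctions.
Context (k : fieldType) (G : torsionFreeZmodType).
Local Notation A := (group_algebra k G).
Local Notation L := (group_algebra_frac k G).
Implicit Types (p q : A) (U : set G) (g h : G) (c : k).

Definition fmonom g : L := tofrac (@gmonom k G g).
Definition fconst c : L := tofrac (c%:A : A).

Lemma fmonom0 : fmonom 0 = 1. Proof. exact: tofrac1. Qed.

Lemma fmonomD g h : fmonom (g + h) = fmonom g * fmonom h.
Proof. by rewrite /fmonom gmonomD tofracM. Qed.

Lemma fmonom_neq0 g : fmonom g != 0.
Proof. by rewrite tofrac_eq0 monalgU_eq0 oner_eq0. Qed.

Lemma fmonomN g : fmonom (- g) = (fmonom g)^-1.
Proof.
apply: (mulIf (fmonom_neq0 g)).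
by rewrite -fmonomD addNr fmonom0 mulVf ?fmonom_neq0.
Qed.

Lemma fmonomMn g n : fmonom (g *+ n) = fmonom g ^+ n.
Proof.
by elim: n => [|n IH]; rewrite ?mulr0n ?expr0 ?fmonom0 // mulrS exprS fmonomD IH.
Qed.

Lemma fconst_eq0 c : (fconst c == 0) = (c == 0).
Proof. by rewrite tofrac_eq0 scaler_eq0 oner_eq0 orbF. Qed.

Lemma fconstM c c' : fconst (c * c') = fconst c * fconst c'.
Proof. by rewrite -tofracM -[in RHS]scalerAl mul1r scalerA. Qed.

Lemma tofrac_fmonomE p : tofrac p = \sum_(g <- msupp p) fconst p@_g * fmonom g.
Proof.
rewrite {1}[p]gmonomE rmorph_sum; apply: eq_bigr => g _.
by rewrite -tofracM -scalerAl mul1r.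
Qed.

Definition supported U p := forall g, p@_g != 0 -> U g.

Lemma supported0 U : supported U 0.
Proof. by move=> g; rewrite mcoeff0 eqxx. Qed.

Lemma supportedD U p q : supported U p -> supported U q -> supported U (p + q).
Proof.
move=> Up Uq g; rewrite mcoeffD; have [->|/Up//] := eqVneq p@_g 0.
by rewrite add0r => /Uq.
Qed.

Lemma supportedN U p : supported U p -> supported U (- p).
Proof. by move=> Up g; rewrite mcoeffN oppr_eq0 => /Up. Qed.

Lemma supportedU U c g : U g -> supported U << c *g g >>.
Proof. by move=> Ug h; rewrite mcoeffU; case: (eqVneq g h) => [<-//|]; rewrite eqxx. Qed.

Lemma supportedC U c : U 0 -> supported U (c%:A : A).
Proof.
move=> U0 g; rewrite mcoeffZ mcoeffU.
by case: (eqVneq 0 g) => [<-//|]; rewrite mulr0 eqxx.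
Qed.

Lemma supportedM U p q : zsubgroup U -> supported U p -> supported U q ->
  supported U (p * q).
Proof.
move=> gU Up Uq g pq; apply: contrapT => nUg; move/eqP: pq; apply; rewrite mcoeffgM.
rewrite big_seq big1 // => x xp; rewrite big_seq big1 // => y yq.
case: eqP => // xyg; case: nUg; rewrite -xyg.
by apply: zsubgroupD => //; [apply: Up|apply: Uq]; rewrite mcoeff_neq0.
Qed.

Lemma mcoeffM_monom p h g : (p * @gmonom k G h)@_g = p@_(g - h).
Proof.
rewrite mulrC [_ * p]gmulUl raddf_sum /=.
have [gp|gp] := boolP (g - h \in msupp p).
  rewrite (big_fsetD1 _ gp) /= big_seq big1 ?addr0.
    by rewrite mcoeffU subrKC eqxx mul1r.
  move=> x; rewrite !inE mcoeffU => /andP[xg _]; case: eqP => // e.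
  by move: xg; rewrite -e addrAC subrr add0r eqxx.
rewrite (mcoeff_outdom gp) big_seq big1 // => x xp; rewrite mcoeffU.
by case: eqP => // e; move: gp; rewrite -e addrAC subrr add0r xp.
Qed.

Definition fracs U : set L :=
  [set f | exists p q, [/\ supported U p, supported U q, q != 0
                         & f * tofrac q = tofrac p]].

Lemma fracs_mono U V : U `<=` V -> fracs U `<=` fracs V.
Proof.
by move=> UV f [p [q [Up Uq q0 e]]]; exists p, q; split=> // g;
  [move/Up/UV|move/Uq/UV].
Qed.

Lemma fracs_tofrac U p : zsubgroup U -> supported U p -> fracs U (tofrac p).
Proof.
move=> [U0 _] Up; exists p, 1; split=> //; last by rewrite tofrac1 mulr1.
- exact: supportedU.
- exact: oner_neq0.
Qed.

Lemma fracs_monom U g : zsubgroup U -> U g -> fracs U (fmonom g).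
Proof. by move=> gU Ug; apply: fracs_tofrac => //; exact: supportedU. Qed.

Lemma fracs_const U c : zsubgroup U -> fracs U (fconst c).
Proof. by move=> gU; apply: fracs_tofrac => //; case: gU => U0 _; exact: supportedC. Qed.

Lemma fracs_divring_closed U : zsubgroup U -> divring_closed [pred f | `[<fracs U f>]].
Proof.
move=> gU; split.
- by apply/asboolP; rewrite -fmonom0; apply: fracs_monom => //; case: gU.
- move=> f f' /asboolP[p [q [Up Uq q0 e]]] /asboolP[p' [q' [Up' Uq' q'0 e']]].
  apply/asboolP; exists (p * q' - p' * q), (q * q'); split.
  + by apply: supportedD; [|apply: supportedN]; exact: supportedM.
  + exact: supportedM.
  + exact: mulf_neq0.
  + by rewrite tofracB !tofracM -e -e'; ring.
- move=> f f' /asboolP[p [q [Up Uq q0 e]]] /asboolP[p' [q' [Up' Uq' q'0 e']]].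
  apply/asboolP; have [p'0|p'0] := eqVneq p' 0.
    have f'0 : f' = 0.
      move/eqP: e'; rewrite p'0 tofrac0 mulf_eq0 tofrac_eq0 (negbTE q'0) orbF.
      by move/eqP.
    by rewrite f'0 invr0 mulr0 -tofrac0; apply: fracs_tofrac => //; exact: supported0.
  exists (p * q'), (q * p'); split.
  + exact: supportedM.
  + exact: supportedM.
  + exact: mulf_neq0.
  + rewrite !tofracM -e -e'; have : f' != 0.
      by apply: contraNneq p'0 => f'0; move/eqP: e'; rewrite f'0 mul0r eq_sym tofrac_eq0.
    by move=> f'0; rewrite (mulrCA (tofrac q)) !mulrA divfK.
Qed.

Lemma fracs_div U f f' : zsubgroup U -> fracs U f -> fracs U f' -> fracs U (f / f').
Proof.
move=> /fracs_divring_closed[_ _ frV] Uf Uf'.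
by apply/asboolP/frV; exact/asboolP.
Qed.

Lemma fracs_horner U (P : {poly L}) f : zsubgroup U ->
  (forall i, fracs U P`_i) -> fracs U f -> fracs U P.[f].
Proof.
move=> gU UP Uf; have [/asboolP fr1 frB _] := fracs_divring_closed gU.
have fr0 : fracs U 0 by apply/asboolP; rewrite -(subrr 1); apply: frB; exact/asboolP.
have frM u v : fracs U u -> fracs U v -> fracs U (u * v).
  move=> Uu Uv; rewrite -[v]invrK -[v^-1]div1r.
  by apply: fracs_div => //; exact: fracs_div.
have frX m : fracs U (f ^+ m).
  elim: m => [|m IH]; first by rewrite expr0.
  by rewrite exprS; exact: frM.
rewrite horner_coef; apply: big_ind.
- exact: fr0.
- move=> u v /asboolP Uu /asboolP Uv; apply/asboolP; rewrite -[v]opprK -[- v]sub0r.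
  by apply: (frB) => //; apply: (frB) => //; exact/asboolP.
- by move=> i _; exact: frM.
Qed.

Lemma fracs_min U (R : set L) : R 0 -> (forall f f', R f -> R f' -> R (f + f')) ->
    (forall f f', R f -> R f' -> R (f / f')) ->
    (forall c g, U g -> R (fconst c * fmonom g)) ->
  fracs U `<=` R.
Proof.
move=> R0 RD RV RU f [p [q [Up Uq q0 e]]].
have Rsum s : supported U s -> R (tofrac s).
  move=> Us; rewrite tofrac_fmonomE big_seq; apply: (big_ind R) => // g gs.
  by apply/RU/Us; rewrite mcoeff_neq0.
have -> : f = tofrac p / tofrac q by rewrite -e mulfK // tofrac_eq0.
by apply: RV; exact: Rsum.
Qed.

Lemma fracs_full (f : L) : fracs setT f.
Proof.
have [p [q [q0 ->]]] := (tofrac_fraction_field A).2 f; exists p, q; split=> //.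
by rewrite divfK // tofrac_eq0.
Qed.

Lemma nonzero_mcoeff p : p != 0 -> exists g, p@_g != 0.
Proof.
move=> p0; apply: contrapT => np; move/eqP: p0; case; apply/malgP => g.
by rewrite mcoeff0; apply/eqP/contraT => pg; case: np; exists g.
Qed.

(** If X^g q = p, then g is a difference of an exponent of p and one of q. *)
Lemma fracs_monom_inv U g : zsubgroup U -> fracs U (fmonom g) -> U g.
Proof.
move=> gU [p [q [Up Uq q0 /eqP]]]; rewrite -tofracM tofrac_eq => /eqP e.
have [h qh] := nonzero_mcoeff q0.
have : p@_(h + g) != 0 by rewrite -e mulrC mcoeffM_monom addrK.
move=> /Up Uhg; rewrite -[g](addKr h) addrC.
by case: gU => _; apply => //; exact: Uq.
Qed.

Lemma fracs_zero_const (f : L) : fracs [set 0] f -> exists c, f = fconst c.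
Proof.
move=> [p [q [Up Uq q0 e]]].
have cE s : supported [set 0] s -> s = (s@_0)%:A :> A.
  move=> Us; apply/malgP => g; rewrite mcoeffZ mcoeffU.
  have [<-|g0] := eqVneq 0 g; first by rewrite mulr1.
  by rewrite mulr0; apply/eqP/contraT => /Us/esym/eqP; rewrite (negbTE g0).
have q00 : q@_0 != 0 by apply: contraNneq q0 => q00; rewrite (cE _ Uq) q00 scale0r.
exists (p@_0 / q@_0); apply: (@mulIf _ (fconst q@_0)); first by rewrite fconst_eq0.
by rewrite -fconstM divfK // /fconst -!cE.
Qed.

Lemma common_denominator U (P : {poly L}) : zsubgroup U ->
    (forall i, fracs U P`_i) ->
  exists (d : A) (r : nat -> A), [/\ supported U d, d != 0, forall i, supported U (r i)
    & forall i, P`_i * tofrac d = tofrac (r i)].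
Proof.
move=> gU; elim/poly_ind: P => [|P c IH] UP.
  exists 1, (fun _ => 0); split.
  - by apply: supportedU; case: gU.
  - exact: oner_neq0.
  - by move=> _; exact: supported0.
  - by move=> i; rewrite coef0 mul0r tofrac0.
have [i|d [r [Ud d0 Ur e]]] := IH.
  by have := UP i.+1; rewrite coefD coefMX coefC addr0.
have := UP 0%N; rewrite coefD coefMX coefC /= add0r.
move=> [p [q [Up Uq q0 e']]]; exists (d * q).
exists (fun i => if i is i'.+1 then r i' * q else p * d); split.
- exact: supportedM.
- exact: mulf_neq0.
- by move=> [|i]; exact: supportedM.
- move=> [|i]; rewrite coefD coefMX coefC /= ?add0r ?addr0 !tofracM.
    by rewrite -e'; ring.
  by rewrite mulrA e.
Qed.

(** After clearing denominators, the terms of the relation have their supports in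
    the disjoint cosets i h + U. *)
Lemma fmonom_transcendental U h (P : {poly L}) : zsubgroup U ->
    (forall n, (0 < n)%N -> ~ U (h *+ n)) -> (forall i, fracs U P`_i) ->
  P.[fmonom h] = 0 -> P = 0.
Proof.
move=> gU nUh UP P0; have [d [r [Ud d0 Ur e]]] := common_denominator gU UP.
have td0 : tofrac d != 0 :> L by rewrite tofrac_eq0.
have sum0 : \sum_(i < size P) r i * gmonom k (h *+ i) = 0.
  apply/eqP; rewrite -tofrac_eq0 -[X in _ == X](mul0r (tofrac d)) -P0.
  rewrite rmorph_sum horner_coef mulr_suml; apply/eqP/eq_bigr => i _ /=.
  by rewrite tofracM -e -/(fmonom _) fmonomMn mulrAC.
apply/polyP => i; rewrite coef0; have [ip|ip] := ltnP i (size P); last exact: nth_default.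
have ri0 : r i = 0.
  apply/malgP => g; rewrite mcoeff0; apply/eqP/contraT => rg.
  have Ug := Ur _ _ rg.
  have := congr1 (mcoeff (g + h *+ i)) sum0; rewrite mcoeff0 raddf_sum /=.
  rewrite (bigD1 (Ordinal ip)) //= mcoeffM_monom addrK big1 ?addr0.
    by move/eqP: rg.
  move=> [j jp] /= ji; rewrite mcoeffM_monom; apply/eqP/contraT => /Ur Ugj.
  have Uhij m n : (n < m)%N -> ~ U (h *+ m - h *+ n).
    by move=> nm; rewrite -mulrnBr ?(ltnW nm) //; apply: nUh; rewrite subn_gt0.
  have Uij : U (h *+ i - h *+ j).
    have -> : h *+ i - h *+ j = (g + h *+ i - h *+ j) - g.
      by rewrite -(addrA g) [g + _]addrC addrK.
    by case: gU => _; apply.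
  have : i != j by apply: contraNneq ji => ij; apply/eqP/val_inj.
  rewrite neq_ltn => /orP[|/Uhij//] /Uhij; case.
  by rewrite -opprB; exact: zsubgroupN.
by apply/eqP; rewrite -(mulIr_eq0 _ (mulIf td0)) e ri0 tofrac0.
Qed.

End RationalFunctions.

(** * The subfield defined by a closed predicate *)
Section Subfield.
Context (L : fieldType) (S : {pred L}) (S_closed : divring_closed S).

(** The proof of closure is an argument so that the algebraic structures, which
    depend on it, are found from the type alone. *)
Definition subfield_pred : {pred L} := let _ := S_closed in S.

HB.instance Definition _ := GRing.isDivringClosed.Build L subfield_pred S_closed.

Record subfield := Subfield {subfield_val : L; _ : subfield_val \in subfield_pred}.

HB.instance Definition _ := [isSub for subfield_val].
HB.instance Definition _ := [Choice of subfield by <:].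
HB.instance Definition _ := [SubChoice_isSubIntegralDomain of subfield by <:].
HB.instance Definition _ := [SubIntegralDomain_isSubField of subfield by <:].
End Subfield.

(** * Pure subgroups *)
Section PureSubgroups.
Context (G : zmodType).
Implicit Types (U P : set G) (g v : G).

Definition pure U := forall v n, (0 < n)%N -> U (v *+ n) -> U v.

Definition pure_span P : set G :=
  [set v | forall U, zsubgroup U -> pure U -> P `<=` U -> U v].

Lemma pure_span_zsubgroup P : zsubgroup (pure_span P).
Proof.
split=> [U [] // |a b Pa Pb U gU pU PU]; case: (gU) => _; apply.
  exact: Pa.
exact: Pb.
Qed.

Lemma pure_span_pure P : pure (pure_span P).
Proof. by move=> v n n0 Pv U gU pU PU; apply: (pU v n) => //; exact: Pv. Qed.

Lemma sub_pure_span P : P `<=` pure_span P.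
Proof. by move=> v Pv U _ _; apply. Qed.

Lemma pure_span_min P U : zsubgroup U -> pure U -> P `<=` U -> pure_span P `<=` U.
Proof. by move=> gU pU PU v; apply. Qed.

(** For a pure U, the smallest pure subgroup containing U and g. *)
Definition isolated_ext U g : set G :=
  [set v | exists m i, (0 < m)%N /\ U (v *+ m - g *~ i)].

Lemma isolated_ext_zsubgroup U g : zsubgroup U -> zsubgroup (isolated_ext U g).
Proof.
move=> gU; have [U0 UB] := gU; split.
  by exists 1%N, 0; rewrite mul0rn mulr0z subr0.
move=> a b [m [i [m0 Ua]]] [n [j [n0 Ub]]].
exists (m * n)%N, (i * n%:Z - j * m%:Z); split; first by rewrite muln_gt0 m0.
have -> : (a - b) *+ (m * n) - g *~ (i * n%:Z - j * m%:Z) =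
    (a *+ m - g *~ i) *~ n%:Z - (b *+ n - g *~ j) *~ m%:Z.
  rewrite mulrnBl mulrzBr !mulrzBl !mulrzA -!pmulrn -!mulrnA [(n * m)%N]mulnC.
  by rewrite !opprB addrACA [RHS]addrACA; congr (_ + _); exact: addrC.
by apply: UB; exact: zsubgroupMz.
Qed.

Lemma isolated_ext_pure U g : pure (isolated_ext U g).
Proof.
move=> v n n0 [m [i [m0 Uv]]]; exists (n * m)%N, i; split.
  by rewrite muln_gt0 n0.
by rewrite mulrnA.
Qed.

Lemma sub_isolated_ext U g : U `<=` isolated_ext U g.
Proof. by move=> v Uv; exists 1%N, 0; rewrite mulr0z subr0. Qed.

Lemma isolated_ext_gen U g : U 0 -> isolated_ext U g g.
Proof. by move=> U0; exists 1%N, 1; rewrite mulr1n mulr1z subrr. Qed.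

(** The quotient of [isolated_ext U g] by U has rank one. Those v for which n! v
    lies in U + Zg form a group which is cyclic modulo U; h_n is the
    generator whose multiple by n! has the least positive coefficient on g. *)
Lemma isolated_ext_tower U g : zsubgroup U -> pure U -> ~ U g ->
  exists h : nat -> G, [/\ forall n, isolated_ext U g (h n),
    forall n m, (0 < m)%N -> ~ U (h n *+ m),
    forall n, exists2 k, (0 < k)%N & U (h n - h n.+1 *+ k)
  & forall v, isolated_ext U g v -> exists n i, U (v - h n *~ i)].
Proof.
move=> gU pU nUg; have [U0 UB] := gU.
pose phi n h (i : int) := U (h *+ n`! - g *~ i).
have ex_min n : exists hi : G * nat, [/\ (0 < hi.2)%N, phi n hi.1 hi.2
    & forall h i, (0 < i)%N -> phi n h i%:Z -> (hi.2 <= i)%N].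
  pose ok i := `[<(0 < i)%N /\ exists h, phi n h i%:Z>].
  have [|i /asboolP[i0 [h hi]] imin] := @ex_minnP ok.
    exists n`!; apply/asboolP; split; first exact: fact_gt0.
    by exists g; rewrite /phi pmulrn subrr.
  exists (h, i); split=> // h' i' i'0 h'i'; apply: imin; apply/asboolP.
  by split=> //; exists h'.
have [hi hiP] := choice ex_min.
pose h n := (hi n).1; pose d n := (hi n).2.
have d0 n : (0 < d n)%N by case: (hiP n).
have hd n : phi n (h n) (d n) by case: (hiP n).
have division n v j : phi n v j -> exists2 q, j = (d n)%:Z * q & U (v - h n *~ q).
  move=> vj; pose q := (j %/ d n)%Z; pose r := (j %% d n)%Z.
  have jE : j = q * d n + r by exact: divz_eq.
  have dz0 : (d n)%:Z != 0 by rewrite eqz_nat -lt0n.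
  have wr : phi n (v - h n *~ q) r.
    have -> : r = j - (d n)%:Z * q by rewrite jE mulrC addrAC subrr add0r.
    rewrite /phi.
    have -> : (v - h n *~ q) *+ n`! - g *~ (j - (d n)%:Z * q) =
      (v *+ n`! - g *~ j) - (h n *+ n`! - g *~ d n) *~ q.
      rewrite mulrnBl mulrzBr mulrzBl mulrzA (pmulrn (_ *~ q)) mulrzAC -pmulrn.
      by rewrite !opprB addrACA [RHS]addrACA; congr (_ + _); exact: addrC.
    by apply: UB => //; apply: zsubgroupMz => //; exact: hd.
  have r0 : r = 0.
    apply/eqP/contraT => rn0; have [_ _ dmin] := hiP n.
    have rge0 : 0 <= r by exact: modz_ge0.
    have : (d n <= `|r|)%N 
      by apply: (dmin (v - h n *~ q)); rewrite ?absz_gt0 // gez0_abs.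
    by rewrite leqNgt -ltz_nat gez0_abs // ltz_mod.
  exists q; first by rewrite jE r0 addr0 mulrC.
  apply: (pU _ n`!); first exact: fact_gt0.
  by move: wr; rewrite /phi r0 mulr0z subr0.
have hext n : isolated_ext U g (h n).
  by exists n`!, (d n); split; [exact: fact_gt0|exact: hd].
exists h; split=> // [n m m0 Uhm|n|v [m [i [m0 Uv]]]].
- apply: nUg; apply: (pU g (d n * m)%N); first by rewrite muln_gt0 d0.
  have -> : g *+ (d n * m) = h n *+ m *+ n`! - (h n *+ n`! - g *~ d n) *+ m.
    by rewrite mulrnBl -!mulrnA [(n`! * _)%N]mulnC opprB addrCA subrr addr0.
  by apply: UB; rewrite pmulrn; apply: zsubgroupMz => //; exact: hd.
- have [|q dq Uq] := division n.+1 (h n) (d n * n.+1)%N.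
    rewrite /phi factS mulnC mulrnA PoszM mulrzA -!pmulrn -mulrnBl.
    by rewrite pmulrn; apply: zsubgroupMz => //; exact: hd.
  have q0 : 0 < q.
    have : 0 < (d n * n.+1)%:Z by rewrite ltz_nat muln_gt0 d0.
    by rewrite dq pmulr_rgt0 // ltz_nat.
  by exists `|q|%N; rewrite ?absz_gt0 ?gt_eqF // pmulrn gtz0_abs.
- have [|q _ Uq] := division m v (i * (m.-1)`!%:Z).
    rewrite /phi -[m in m`!](prednK m0) factS prednK // mulrnA mulrzA.
    by rewrite -pmulrn -mulrnBl pmulrn; exact: zsubgroupMz.
  by exists m, q.
Qed.

End PureSubgroups.

(** * Freeness modulo monomials *)
Lemma directed_seq (W : eqType) (R : rel W) (T : eqType) (I : set W)
    (D : W -> set T) (s : seq T) :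
    well_order R -> (forall w w', R w w' -> D w `<=` D w') -> s != [::] ->
    (forall t, t \in s -> exists2 w, I w & D w t) ->
  exists2 w, I w & forall t, t \in s -> D w t.
Proof.
move=> woR mono; elim: s => [//|t s IH] _ sD.
have [w Iw Dwt] := sD t (mem_head _ _).
have [->|s0] := eqVneq s [::].
  by exists w => // t'; rewrite inE => /eqP->.
have [||w' Iw' Dw'] := IH; first by [].
  by move=> t' t's; apply: sD; rewrite inE t's orbT.
have [ww'|w'w] := orP (wo_total woR w w').
  by exists w' => // t'; rewrite inE => /orP[/eqP->|/Dw'//]; exact: mono Dwt.
by exists w => // t'; rewrite inE => /orP[/eqP->//|/Dw']; exact: mono.
Qed.

Section RelativeFreenessModMonomials.
Context (k : fieldType) (G : torsionFreeZmodType) (H : zmodType).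
Local Notation L := (group_algebra_frac k G).
Context (Y : H -> L).
Hypothesis k_roots : forall n, (0 < n)%N -> exists z : k, n.-primitive_root z.
Hypothesis YB : forall a b, Y (a - b) = Y a / Y b.
Hypothesis Y_neq0 : forall a, Y a != 0.
Local Notation X := (@fmonom k G).

(** The preimage under [Y] of the group generated by all monomials and by the
    nonzero rational functions supported on [U]. *)
Definition over (U : set G) : set H := [set a | exists v, fracs U (Y a / X v)].

Let Y0 : Y 0 = 1. Proof. by rewrite -(subrr 0) YB divff. Qed.

Lemma over_zsubgroup U : zsubgroup U -> zsubgroup (over U).
Proof.
move=> gU; split.
  exists 0; rewrite Y0 fmonom0 divr1 -fmonom0; apply: fracs_monom => //.
  by case: gU.
move=> a b [v va] [w wb]; exists (v - w).
have -> : Y (a - b) / X (v - w) = (Y a / X v) / (Y b / X w).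
  by rewrite YB fmonomD fmonomN !invfM !invrK mulrACA.
exact: fracs_div.
Qed.

Lemma over_mono U V : U `<=` V -> over U `<=` over V.
Proof. by move=> UV a [v va]; exists v; exact: fracs_mono va. Qed.

Let monom_shift a h (i : int) : exists al be, X a * X h ^+ al = X (a - h *~ i) * X h ^+ be.
Proof.
case: (intP i) => [|n|n].
- by exists 0%N, 0%N; rewrite mulr0z subr0.
- by exists 0%N, n.+1; rewrite expr0 mulr1 -fmonomMn -fmonomD -pmulrn subrK.
- by exists n.+1, 0%N; rewrite expr0 mulr1 -fmonomMn -fmonomD mulrNz opprK -pmulrn.
Qed.

Section Step.
Context (U : set G) (g : G) (gU : zsubgroup U) (pU : pure U) (nUg : ~ U g).

Let K := subfield (fracs_divring_closed k gU).
Let j : {rmorphism K -> L} := val.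

Let jP (c : K) : fracs U (j c). Proof. by apply/asboolP; case: c. Qed.

Let jS f : fracs U f -> exists c : K, j c = f.
Proof. by move=> /asboolP Uf; exists (Subfield Uf). Qed.

(** With K the field of fractions supported on U and x_n = X^(h_n), the radical
    tower starts at K and exhausts the fractions supported on the extension. *)
Lemma over_isolated_ext : relfree (over U) (over (isolated_ext U g)).
Proof.
have [h [hext nUh hS hcover]] := isolated_ext_tower gU pU nUg.
have [U0 _] := gU; pose V := isolated_ext U g.
pose W n := [set v | exists i, U (v - h n *~ i)].
have gW n : zsubgroup (W n).
  split; first by exists 0; rewrite mulr0z subr0.
  move=> v w [i Uv] [i' Uw]; exists (i - i').
  have -> : v - w - h n *~ (i - i') = (v - h n *~ i) - (w - h n *~ i').
    by rewrite mulrzBr !opprB addrACA [RHS]addrACA; congr (_ + _); exact: addrC.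
  by case: (gU) => _; apply.
have UW n : U `<=` W n by move=> v Uv; exists 0; rewrite mulr0z subr0.
have Wh n : W n (h n) by exists 1; rewrite mulr1z subrr.
have W_mono m n : (m <= n)%N -> W m `<=` W n.
  move/subnK <-; elim: (n - m)%N => // l IH v /IH [i Uv].
  have [q _ Uq] := hS (l + m)%N; exists (q%:Z * i); rewrite mulrzA -pmulrn.
  rewrite -[v](subrK (h (l + m)%N *~ i)) -addrA -mulrzBl.
  by apply: zsubgroupD => //; exact: zsubgroupMz.
have gV : zsubgroup V by exact: isolated_ext_zsubgroup.
pose M : set L := [set f | exists v, f = X v].
pose x n := X (h n).
have coefP (P : {poly K}) i : fracs U (map_poly j P)`_i by rewrite coef_map; exact: jP.
have x_transc n (P : {poly K}) : (map_poly j P).[x n] = 0 -> P = 0.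
  move=> /(fmonom_transcendental gU (nUh n) (coefP P)) P0.
  by apply/eqP; rewrite -(map_poly_eq0 j) P0.
have ev0 n : (map_poly j 0).[x n] = 0 by rewrite map_poly0 horner0.
have evX1 n m : (map_poly j 'X^m).[x n] = x n ^+ m by rewrite map_polyXn hornerXn.
have evC1 n (c : K) m : (map_poly j (c%:P * 'X^m)).[x n] = j c * x n ^+ m.
  by rewrite rmorphM hornerM evX1 /= (map_polyC j) hornerC.
have ev_fracs Z n (P : {poly K}) : zsubgroup Z -> U `<=` Z -> Z (h n) ->
    fracs Z (map_poly j P).[x n].
  move=> gZ UZ Zh; apply: fracs_horner => // [i|]; last exact: fracs_monom.
  by apply: (fracs_mono UZ); exact: coefP.
have -> : over U = @ground K L j M H Y.
  apply/seteqP; split=> a.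
    move=> [v /jS[c e]]; exists (X v), c; split; first by exists v.
      by rewrite -(fmorph_eq0 j) e mulf_neq0 // invr_eq0 fmonom_neq0.
    by rewrite e mulrC divfK ?fmonom_neq0.
  move=> [_ [c [[v ->] c0 e]]]; exists v; rewrite e mulrC mulKf ?fmonom_neq0 //.
have -> : over V = \bigcup_n @level K L j M x H Y n.
  apply/seteqP; split=> a.
    move=> [v Vf]; set f := Y a / X v in Vf.
    have [n [P [Q [Q0 e]]]] : exists n (P Q : {poly K}),
        Q != 0 /\ f * (map_poly j Q).[x n] = (map_poly j P).[x n].
      have [p [q [Vp Vq q0 e]]] := Vf.
      have [||r rs|n _ nW] := @directed_seq _ leq _ setT W (msupp p ++ msupp q) leq_well_order.
      - exact: W_mono.
      - have [r qr] := nonzero_mcoeff q0; apply/eqP => /(congr1 (fun s => r \in s)).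
        by rewrite mem_cat -!mcoeff_neq0 qr orbT.
      - have [|n [i Ui]] := hcover r; last by exists n => //; exists i.
        by move: rs; rewrite mem_cat -!mcoeff_neq0 => /orP[/Vp|/Vq].
      exists n.
      have Wf : fracs (W n) f.
        exists p, q; split=> // r rs; apply: nW; rewrite mem_cat -!mcoeff_neq0 rs ?orbT //.
      have evN0 (Q : {poly K}) : Q != 0 -> (map_poly j Q).[x n] != 0.
        by move=> Q0; apply/eqP => /x_transc/eqP; rewrite (negbTE Q0).
      suff : fracs (W n) `<=` [set f | exists P Q : {poly K},
          Q != 0 /\ f * (map_poly j Q).[x n] = (map_poly j P).[x n]] by apply.
      apply: fracs_min => {f Vf e Wf} [|||c u [i Uu]].
      - exists 0, 1; split; first exact: oner_neq0.
        exact: etrans (mul0r _) (esym (ev0 n)).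
      - move=> f f' [P [Q [Q0 e]]] [P' [Q' [Q'0 e']]].
        exists (P * Q' + P' * Q), (Q * Q'); split; first exact: mulf_neq0.
        by rewrite rmorphD !rmorphM /= hornerD !hornerM -e -e'; ring.
      - move=> f f' [P [Q [Q0 e]]] [P' [Q' [Q'0 e']]].
        have [->|f'0] := eqVneq f' 0.
          exists 0, 1; split; first exact: oner_neq0.
          rewrite invr0 mulr0; exact: etrans (mul0r _) (esym (ev0 n)).
        exists (P * Q'), (Q * P'); split.
          apply: mulf_neq0 => //; apply: contraNneq f'0 => P'0; move/eqP: e'.
          by rewrite P'0 rmorph0 horner0 mulf_eq0 (negbTE (evN0 _ Q'0)) orbF.
        rewrite !rmorphM /= !hornerM -e -e' (mulrCA (map_poly j Q).[_]).
        by rewrite !mulrA divfK.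
      - have [al [be shift]] := monom_shift u (h n) i.
        have [d dE] := jS (fracs_monom k gU Uu).
        have [w wE] := jS (fracs_const c gU).
        exists ((w * d)%:P * 'X^be), 'X^al; split; first by rewrite expf_neq0 // polyX_eq0.
        by rewrite evC1 evX1 (rmorphM j) dE wE -!mulrA shift.
    exists n => //; exists (X v), P, Q; split=> //; first by exists v.
      apply: contraNneq (Y_neq0 a) => P0; move/eqP: e; rewrite P0 rmorph0 horner0.
      rewrite mulf_eq0 => /orP[|/eqP /x_transc/eqP]; last by rewrite (negbTE Q0).
      by rewrite /f mulf_eq0 invr_eq0 (negbTE (fmonom_neq0 _ _)) orbF.
    by rewrite -e mulrA [X v * _]mulrC divfK ?fmonom_neq0.
  move=> [n _ [_ [P [Q [[v ->] P0 Q0 e]]]]]; exists v.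
  have -> : Y a / X v = (map_poly j P).[x n] / (map_poly j Q).[x n].
    apply/eqP; rewrite eqr_div ?fmonom_neq0 // ?e 1?mulrC //.
    by apply/eqP => /x_transc/eqP; rewrite (negbTE Q0).
  by apply: fracs_div => //; apply: ev_fracs => //;
    [exact: sub_isolated_ext|exact: hext|exact: sub_isolated_ext|exact: hext].
apply: radical_tower_relfree => //.
- by exists 0; rewrite fmonom0.
- by move=> _ _ [v ->] [w ->]; exists (v + w); rewrite fmonomD.
- by move=> _ [v ->]; exists (- v); rewrite fmonomN.
- by move=> _ [v ->]; exact: fmonom_neq0.
- by move=> n; exists (h n).
- move=> n; have [m m0 Um] := hS n; have [z zP] := k_roots m0.
  have [c cE] := jS (fracs_monom k gU Um).
  have [w wE] := jS (fracs_const z gU).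
  exists c, m, w; split=> //.
  + by rewrite -(fmorph_eq0 j) cE fmonom_neq0.
  + rewrite -(fmorph_primitive_root j) wE.
    pose cst : {rmorphism k -> L} := @tofrac (group_algebra k G) \o in_alg (group_algebra k G).
    by rewrite -[fconst _ _]/(cst z) fmorph_primitive_root.
  + by rewrite cE /x -fmonomMn -fmonomD subrK.
- move=> n _ P Q [a ->] P0 e.
  have [i Ui] : W n a.
    apply: (fracs_monom_inv (k := k) (gW n)).
    have -> : X a = (map_poly j Q).[x n] / (map_poly j P).[x n].
      rewrite -e mulfK //; apply/eqP => /x_transc/eqP; by rewrite (negbTE P0).
    by apply: fracs_div => //; exact: ev_fracs.
  have [c cE] := jS (fracs_monom k gU Ui); have [al [be shift]] := monom_shift a (h n) i.
  exists c, al, be; split; last by rewrite cE.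
  by rewrite -(fmorph_eq0 j) cE fmonom_neq0.
Qed.

End Step.

Lemma supports_directed (I : set G) (V : G -> set G) (R : rel G) (p q : group_algebra k G) :
    well_order R -> (forall w w', R w w' -> V w `<=` V w') ->
    (forall w, V w 0) -> q != 0 ->
    (forall t, (p@_t != 0) || (q@_t != 0) -> t = 0 \/ exists2 w, I w & V w t) ->
  supported [set 0] p /\ supported [set 0] q \/
  exists2 w, I w & supported (V w) p /\ supported (V w) q.
Proof.
move=> woR mono V0 q0 pqV; pose s := [seq t <- msupp p ++ msupp q | t != 0].
have sE t : (p@_t != 0) || (q@_t != 0) -> t = 0 \/ t \in s.
  have [->|t0] := eqVneq t 0; first by left.
  by right; rewrite mem_filter t0 mem_cat -!mcoeff_neq0.
have [s0|s0] := eqVneq s [::].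
  by left; split=> t tp; case: (sE t); rewrite ?tp ?orbT // s0.
right; have [t|w Iw wV] := @directed_seq _ R _ I V s woR mono s0.
  rewrite mem_filter mem_cat -!mcoeff_neq0 => /andP[t0 /pqV[t00|//]].
  by rewrite t00 eqxx in t0.
by exists w => //; split=> t tp; case: (sE t) => [|->|/wV]; rewrite ?tp ?orbT.
Qed.

(** G is exhausted by the pure subgroups spanned by the elements up to g, for a
    well-order of G; going from the elements before g to the elements up to g
    either changes nothing or is one isolated extension. A fraction has a finite
    support, so it never first appears at a limit. *)
Theorem relfree_mod_monomials :
  relfree [set a | exists c v, c != 0 /\ Y a = fconst G c * X v] setT.
Proof.
have [R woR] := well_ordering_principle G.
have Rxx := wo_refl woR; have Rtrans := wo_trans woR.
have g0 : zsubgroup [set (0 : G)].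
  by split=> // a b -> ->; rewrite subrr.
have -> : [set a | exists c v, c != 0 /\ Y a = fconst G c * X v] = over [set 0].
  apply/seteqP; split=> a.
    move=> [c [v [c0 e]]]; exists v; rewrite e mulfK ?fmonom_neq0 //.
    exact: fracs_const.
  move=> [v /fracs_zero_const[c e]]; exists c, v; split; last first.
    by rewrite -e divfK ?fmonom_neq0.
  rewrite -(fconst_eq0 G) -e mulf_eq0 invr_eq0 (negbTE (fmonom_neq0 _ _)) orbF.
  exact: Y_neq0.
pose V g := pure_span [set x | R x g].
pose Vl g := pure_span [set x | R x g /\ x != g].
have gV g : zsubgroup (V g) by exact: pure_span_zsubgroup.
have gVl g : zsubgroup (Vl g) by exact: pure_span_zsubgroup.
have Vmono g g' : R g g' -> V g `<=` V g'.
  move=> gg'; apply: pure_span_min; first exact: gV.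
    exact: pure_span_pure.
  by move=> x xg; apply: sub_pure_span; exact: Rtrans gg'.
have Vg g : V g g by apply: sub_pure_span; exact: Rxx.
have V0 g : V g 0 by case: (gV g).
have Vl_V g : Vl g `<=` V g.
  apply: pure_span_min; first exact: gV.
    exact: pure_span_pure.
  by move=> x [xg _]; exact: sub_pure_span.
apply: (@relfree_chain _ _ R _ (fun g => over (V g))) => //.
- exact: over_zsubgroup.
- by move=> g; exact: over_zsubgroup.
- by move=> g; apply: over_mono => _ ->; exact: V0.
- by move=> g g' gg'; exact: over_mono (Vmono _ _ gg').
- move=> g; pose I w := R w g /\ w != g.
  have VlE t : Vl g t -> t = 0 \/ exists2 w, I w & V w t.
    move: t; apply: pure_span_min.
    + split; first by left.
      have VB w a b : V w a -> V w b -> V w (a - b) by case: (gV w) => _; apply.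
      move=> a b [->|[w Iw wa]] [->|[w' Iw' wb]].
      * by left; rewrite subrr.
      * by right; exists w' => //; exact: VB.
      * by right; exists w => //; exact: VB.
      * right; have [ww'|w'w] := orP (wo_total woR w w').
          by exists w' => //; apply: VB => //; exact: Vmono wa.
        by exists w => //; apply: VB => //; exact: Vmono wb.
    + move=> v n n0 [/mulrn_torsion_free|[w Iw wv]]; first by left; auto.
      by right; exists w => //; apply: pure_span_pure wv.
    + by move=> x Ix; right; exists x.
  have -> : [set a | over [set 0] a \/ exists w, [/\ R w g, w != g & over (V w) a]]
      = over (Vl g).
    apply/seteqP; split=> a.
      move=> [|[w [wg wng]]]; apply: over_mono.
        by move=> _ ->; case: (gVl g).
      apply: pure_span_min; first exact: gVl.
        exact: pure_span_pure.
      move=> x xw; apply: sub_pure_span; split; first exact: Rtrans wg.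
      apply: contraNneq wng => xg; apply/eqP/(wo_anti woR).
      by rewrite wg -xg.
    move=> [v [p [q [Vp Vq q0 e]]]].
    have [|[p00 q00]|[w [wg wng] [wp wq]]] := @supports_directed I V R p q woR Vmono V0 q0.
    + by move=> t /orP[/Vp|/Vq]; exact: VlE.
    + by left; exists v, p, q.
    + by right; exists w; split=> //; exists v, p, q.
  have [Vlg|nVlg] := pselect (Vl g g).
    apply: relfree_refl; apply: over_mono; apply: pure_span_min; first exact: gVl.
      exact: pure_span_pure.
    move=> x xg; have [->//|xng] := eqVneq x g; by apply: sub_pure_span; split.
  have -> : V g = isolated_ext (Vl g) g.
    apply/seteqP; split.
      apply: pure_span_min; first exact: isolated_ext_zsubgroup.
        exact: isolated_ext_pure.
      move=> x xg; have [->|xng] := eqVneq x g.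
        by apply: isolated_ext_gen; case: (gVl g).
      by apply: sub_isolated_ext; apply: sub_pure_span; split.
    move=> v [m [i [m0 Uv]]]; apply: (pure_span_pure m0).
    rewrite -(subrK (g *~ i) (v *+ m)); apply: (zsubgroupD (gV g)).
      exact: Vl_V.
    by apply: (zsubgroupMz i (gV g)); exact: Vg.
  by apply: over_isolated_ext => //; exact: pure_span_pure.
- move=> a; split=> // _; have [p [q [_ _ q0 e]]] := fracs_full (Y a).
  have [|[p00 q00]|[w _ [wp wq]]] := @supports_directed setT V R p q woR Vmono V0 q0.
  + by move=> t _; right; exists t.
  + by left; exists 0, p, q; split=> //; rewrite fmonom0 divr1.
  + by right; exists w, 0, p, q; split=> //; rewrite fmonom0 divr1.
Qed.
End RelativeFreenessModMonomials.

(** * Matchings *)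
Section FiniteMatchings.

(** Some maximal square block of A is invertible; a nonzero term in the Leibniz
    expansion of its determinant is the matching. *)
Lemma left_inverse_matching (F : fieldType) (m n : nat)
    (B : 'M[F]_(n, m)) (A : 'M[F]_(m, n)) : B *m A = 1%:M ->
  exists2 f : 'I_n -> 'I_m, injective f & forall i, A (f i) i != 0.
Proof.
move=> BA1; have fullA : row_full A.
  by apply/row_fullP; exists B.
have := fullrowsub_unit fullA; set C := rowsub _ A => uC.
have [s sP] : exists s : 'S_n, forall i, C i (s i) != 0.
  apply: contrapT => ns; move: uC; rewrite unitmxE unitfE => /eqP; apply.
  rewrite /determinant big1 // => s _; apply/eqP; rewrite mulf_eq0; apply/orP; right.
  have [i /negP/negPn/eqP Ci0] : exists i, ~ C i (s i) != 0.
    apply: contrapT => ni; apply: ns; exists s => i.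
    by apply: contrapT => ?; apply: ni; exists i.
  by apply/prodf_eq0; exists i => //; apply/eqP.
exists (fun i => fullrankfun fullA (s^-1%g i)).
  by move=> i j /fullrankfun_inj/perm_inj.
by move=> i; have := sP (s^-1%g i); rewrite permKV mxE.
Qed.

(** Compactness. Take an ultrafilter on the finite parts of A that contains, for
    each of them, the set of the larger ones. The candidates S a being finite in
    number, one of them is the value at a of almost all the finite matchings, and
    two coincident limit values would already coincide in one of these. *)
Lemma infinite_matching (T T' : choiceType) (A : set T) (S : T -> seq T') :
    (forall s : seq T, (forall a, a \in s -> A a) -> exists f : T -> T',
       {in s &, injective f} /\ forall a, a \in s -> f a \in S a) ->
  exists f : T -> T', {in A &, injective f} /\ forall a, A a -> f a \in S a.
Proof.
move=> fin.
have [fm fmP] : {f : seq T -> T -> T' & forall s, (forall a, a \in s -> A a) ->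
    {in s &, injective (f s)} /\ forall a, a \in s -> f s a \in S a}.
  have [f0 _] := cid (fin [::] (fun a (h : a \in [::]) => match notF h with end)).
  apply: (@choice _ _ (fun s f => (forall a, a \in s -> A a) ->
    {in s &, injective f} /\ forall a, a \in s -> f a \in S a)) => s.
  have [/fin[f fP]|nsA] := pselect (forall a, a \in s -> A a); first by exists f.
  by exists f0.
pose F : set_system (seq T) := [set P : set (seq T) |
  exists2 s0 : seq T, (forall a, a \in s0 -> A a) &
  forall s : seq T, (forall a, a \in s -> A a) -> {subset s0 <= s} -> P s].
have FF : Filter F.
  split.
  - by exists [::].
  - move=> P Q [s sA sP] [t tA tQ]; exists (s ++ t).
      by move=> a; rewrite mem_cat => /orP[/sA|/tA].
    move=> r rA str; split; [apply: sP|apply: tQ] => // a ar;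
    by apply: str; rewrite mem_cat ar ?orbT.
  - by move=> P Q PQ [s sA sP]; exists s => // t tA st; apply: PQ; exact: sP.
have PF : ProperFilter F.
  by apply: Build_ProperFilter_ex => P [s sA sP]; exists s; exact: sP.
have [U [UU FU]] := ultraFilterLemma PF.
have UsubA (t : seq T) : (forall a, a \in t -> A a) ->
    U [set s : seq T | (forall a, a \in s -> A a) /\ {subset t <= s}].
  by move=> tA; apply: FU; exists t.
have pick a : A a -> exists2 b, b \in S a & U [set s | fm s a = b].
  move=> Aa; have : U [set s | fm s a \in S a].
    have aA x : x \in [:: a] -> A x by rewrite inE => /eqP->.
    apply: filterS (UsubA [:: a] aA) => s [sA as_]; apply: (fmP s sA).2.
    by apply: as_; rewrite mem_head.
  elim: (S a) => [|b r IH] Ur.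
    have /filter_ex[s] : U set0 by apply: filterS Ur.
    by [].
  have [Ub|Unb] := in_ultra_setVsetC [set s | fm s a = b] UU.
    by exists b; rewrite ?mem_head.
  have [|b' b'r Ub'] := IH; last by exists b' => //; rewrite inE b'r orbT.
  apply: filterS (filterI Ur Unb) => s [/=]; rewrite inE => /orP[/eqP->|//].
  by move/(_ erefl).
have [f fP] : {f : T -> T' & forall a, A a -> f a \in S a /\ U [set s | fm s a = f a]}.
  have [f0 _] := cid (fin [::] (fun a (h : a \in [::]) => match notF h with end)).
  apply: (@choice _ _ (fun a b => A a -> b \in S a /\ U [set s | fm s a = b])) => a.
  have [/pick[b bS Ub]|nA] := pselect (A a); first by exists b.
  by exists (f0 a).
exists f; split=> [a a'|a Aa]; last by case: (fP _ Aa).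
rewrite !inE => Aa Aa' faa'; have [_ Ua] := fP _ Aa; have [_ Ua'] := fP _ Aa'.
have aA x : x \in [:: a; a'] -> A x by rewrite !inE => /orP[]/eqP->.
have [s [[sa sa'] [sA as_]]] := filter_ex (filterI (filterI Ua Ua') (UsubA _ aA)).
apply: (fmP s sA).1; rewrite ?as_ ?inE ?eqxx ?orbT //.
by rewrite sa sa'.
Qed.

End FiniteMatchings.

(** * Dual bases *)
Section DualBasis.
Context (H : zmodType) (S E : set H).
Hypotheses (gS : zsubgroup S) (bE : basis_mod S E setT).

(* Requiring m to vanish outside the finite set s makes m itself unique. *)
Let coords h (m : H -> int) := exists s, [/\ uniq s, forall e, e \in s -> E e,
  forall e, m e != 0 -> e \in s & S (h - lincomb s m)].

Let lincomb_widen (s t : seq H) (m : H -> int) : uniq s -> uniq t -> {subset s <= t} ->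
  (forall e, m e != 0 -> e \in s) -> lincomb t m = lincomb s m.
Proof.
move=> us ut st ms; rewrite /lincomb (bigID (mem s)) /= [X in _ + X]big1 ?addr0.
  rewrite -big_filter; apply/perm_big/uniq_perm => //; first exact: filter_uniq.
  move=> e; rewrite mem_filter /=; case es : (e \in s) => //=.
  exact: st.
move=> e es; have -> : m e = 0 by apply/eqP; apply: contraNT es; exact: ms.
exact: mulr0z.
Qed.

Let coords_uniq h m m' : coords h m -> coords h m' -> m = m'.
Proof.
move=> [s [us sE ms Sm]] [s' [us' s'E ms' Sm']]; apply/funext => e.
pose t := undup (s ++ s').
have ut : uniq t by exact: undup_uniq.
have st : {subset s <= t} by move=> x xs; rewrite mem_undup mem_cat xs.
have s't : {subset s' <= t} by move=> x xs; rewrite mem_undup mem_cat xs orbT.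
have [_ indep _] := bE.
have mt : forall e, e \in t -> m e - m' e = 0.
  apply: (indep t (fun e => m e - m' e)) => //.
    by move=> x; rewrite mem_undup mem_cat => /orP[/sE|/s'E].
  have -> : lincomb t (fun e => m e - m' e) = (h - lincomb s' m') - (h - lincomb s m).
    rewrite -(lincomb_widen us ut) // -(lincomb_widen us' ut) //.
    rewrite opprB addrA addrAC [_ - _ - h]addrAC subrr sub0r addrC /lincomb -sumrB.
    by apply: eq_bigr => x _; rewrite mulrzBr.
  by case: gS => _; apply.
have [/mt/eqP|et] := boolP (e \in t); first by rewrite subr_eq0 => /eqP.
have m0 : m e = 0 by apply/eqP; apply: contraNT et => /ms /st.
have m'0 : m' e = 0 by apply/eqP; apply: contraNT et => /ms' /s't.
by rewrite m0 m'0.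
Qed.

Let coordsB a b m m' : coords a m -> coords b m' -> coords (a - b) (fun e => m e - m' e).
Proof.
move=> [s [us sE ms Sm]] [s' [us' s'E ms' Sm']].
pose t := undup (s ++ s').
have ut : uniq t by exact: undup_uniq.
have st : {subset s <= t} by move=> x xs; rewrite mem_undup mem_cat xs.
have s't : {subset s' <= t} by move=> x xs; rewrite mem_undup mem_cat xs orbT.
exists t; split=> //.
- by move=> x; rewrite mem_undup mem_cat => /orP[/sE|/s'E].
- move=> e; have [m0|/ms/st//] := eqVneq (m e) 0.
  by rewrite m0 sub0r oppr_eq0 => /ms'/s't.
- have -> : a - b - lincomb t (fun e => m e - m' e)
      = (a - lincomb s m) - (b - lincomb s' m').
    rewrite -(lincomb_widen us ut) // -(lincomb_widen us' ut) //.
    have -> : lincomb t (fun e => m e - m' e) = lincomb t m - lincomb t m'.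
      by rewrite /lincomb -sumrB; apply: eq_bigr => x _; rewrite mulrzBr.
    by rewrite !opprB addrACA [RHS]addrACA; congr (_ + _); exact: addrC.
  by case: gS => _; apply.
Qed.

Let coordsP h : exists m, coords h m.
Proof.
have [_ _ span] := bE; apply: (span [set h | exists m, coords h m]) => // [|a Sa|e Ee].
- split=> [|a b [m am] [m' bm']]; last by eexists; exact: coordsB am bm'.
  exists (fun _ => 0), [::]; split=> //; rewrite /lincomb big_nil subr0.
  by case: gS.
- by exists (fun _ => 0), [::]; split=> //; rewrite /lincomb big_nil subr0.
- exists (fun x => (x == e)%:Z), [:: e]; split=> //.
  + by move=> x; rewrite inE => /eqP->.
  + by move=> x; rewrite inE; case: (x == e).
  + by rewrite /lincomb big_seq1 eqxx mulr1z subrr; case: gS.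
Qed.

Lemma dual_basis : exists lam : H -> H -> int,
  [/\ forall e a b, lam e (a - b) = lam e a - lam e b,
      forall e a, S a -> lam e a = 0,
      forall e e', E e' -> lam e e' = (e' == e)%:Z
    & forall a, exists s, [/\ uniq s, forall e, e \in s -> E e,
        forall e, lam e a != 0 -> e \in s & S (a - lincomb s (lam^~ a))]].
Proof.
have [c cP] := choice coordsP; exists (fun e a => c a e); split.
- move=> e a b; exact: (congr1 (fun m => m e) (coords_uniq (cP _) (coordsB (cP a) (cP b)))).
- move=> e a Sa; apply: (congr1 (fun m => m e) (coords_uniq (m' := fun _ => 0) (cP a) _)).
  by exists [::]; split=> //; rewrite /lincomb big_nil subr0.
- move=> e e' Ee'.
  rewrite (coords_uniq (m' := fun x => (x == e')%:Z) (cP e')) 1?eq_sym //.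
  exists [:: e']; split=> //.
  + by move=> x; rewrite inE => /eqP->.
  + by move=> x; rewrite inE; case: (x == e').
  + by rewrite /lincomb big_seq1 eqxx mulr1z subrr; case: gS.
- exact: cP.
Qed.

End DualBasis.

(** * Derivations *)
Definition derivation (L : fieldType) (D : L -> L) :=
  (forall u v, D (u + v) = D u + D v) /\ (forall u v, D (u * v) = D u * v + u * D v).

(** The quotient rule; its value does not depend on the fraction chosen. *)
Lemma derivation_extends (R : idomainType) (F : fieldType) (f : {rmorphism R -> F})
    (d : R -> R) : fraction_field_of f ->
    (forall a b, d (a + b) = d a + d b) ->
    (forall a b, d (a * b) = d a * b + a * d b) ->
  exists D : F -> F, derivation D /\ forall a, D (f a) = f (d a).
Proof.
move=> [finj ffrac] dD dM.
have f0 a : (f a == 0) = (a == 0) by rewrite -(inj_eq finj) rmorph0.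
have [r rP] : {r : F -> R * R & forall u, (r u).2 != 0 /\ u = f (r u).1 / f (r u).2}.
  apply: (@choice _ _ (fun u r => r.2 != 0 /\ u = f r.1 / f r.2)) => u.
  by have [a [b h]] := ffrac u; exists (a, b).
pose q a b := (f (d a) * f b - f a * f (d b)) / (f b * f b).
pose D u := q (r u).1 (r u).2.
have DE (a b : R) u : b != 0 -> u = f a / f b -> D u = q a b.
  move=> b0 uE; have [e0 uE'] := rP u; rewrite /D; move: (r u).1 (r u).2 e0 uE'.
  move=> c e e0 uE'; have fb0 : f b != 0 by rewrite f0.
  have fe0 : f e != 0 by rewrite f0.
  have e1 : a * e = c * b.
    apply: finj; rewrite !rmorphM; apply/eqP.
    by rewrite -eqr_div // -uE -uE'.
  have := congr1 (f \o d) e1; rewrite /= !dM !rmorphD !rmorphM => e2.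
  have A : f a = f c * f b / f e by rewrite -rmorphM -e1 rmorphM mulfK.
  have A' : f (d a) = (f (d c) * f b + f c * f (d b) - f a * f (d e)) / f e.
    by rewrite -e2 addrK mulfK.
  by rewrite /q A' A; field; exact/andP.
have D0 : d 1 = 0.
  by have := dM 1 1; rewrite !mulr1 mul1r -[X in X = _]addr0 => /addrI.
exists D; split; last first.
  move=> a; rewrite (DE a 1) ?oner_neq0 ?rmorph1 ?divr1 //.
  by rewrite /q D0 rmorph0 rmorph1 !mulr1 mulr0 subr0 divr1.
split=> u v; have [b0 uE] := rP u; have [e0 vE] := rP v.
all: move: (r u).1 (r u).2 (r v).1 (r v).2 b0 uE e0 vE => a b a' b' b0 uE b'0 vE.
all: rewrite (DE _ _ _ b0 uE) (DE _ _ _ b'0 vE).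
  have e : u + v = f (a * b' + a' * b) / f (b * b').
    by rewrite uE vE addf_div ?f0 // rmorphD !rmorphM.
  rewrite (DE _ _ _ _ e) ?mulf_neq0 // /q !dD !dM !rmorphD !rmorphM.
  by move: b0 b'0; rewrite -!f0 => b0 b'0; field; exact/andP.
have e : u * v = f (a * a') / f (b * b') by rewrite uE vE mulf_div !rmorphM.
rewrite (DE _ _ _ _ e) ?mulf_neq0 // /q uE vE !dM !rmorphD !rmorphM.
by move: b0 b'0; rewrite -!f0 => b0 b'0; field; exact/andP.
Qed.

Lemma leibniz_mulz (R : comNzRingType) (x y z w : R) (m n : int) :
  x * y * (z * w *~ m + z * w *~ n) = x * (z *~ m) * (y * w) + x * z * (y * (w *~ n)).
Proof. by rewrite mulrDr !mulrzAr !mulrzAl; congr (_ *~ _ + _ *~ _); ring. Qed.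

Section EulerDerivation.
Context (k : fieldType) (G : torsionFreeZmodType) (F : fieldType).
Context (iota : {rmorphism group_algebra k G -> F}) (lam : G -> int).
Hypothesis frac_iota : fraction_field_of iota.
Hypothesis lamB : forall a b, lam (a - b) = lam a - lam b.
Local Notation A := (group_algebra k G).

(** The derivation multiplying X^g by lam g, which generalizes the operator
    x d/dx. *)
Lemma euler_derivation : exists D : F -> F, [/\ derivation D,
  forall g, D (iota (gmonom k g)) = (lam g)%:~R * iota (gmonom k g)
  & forall c, D (iota (c%:A : A)) = 0].
Proof.
have lam0 : lam 0 = 0 by rewrite -(subrr 0) lamB subrr.
have lamD a b : lam (a + b) = lam a + lam b.
  by rewrite -{1}[b]opprK lamB -[- b]sub0r lamB lam0 sub0r opprK.
pose d : A -> A := mmap (in_alg A) (fun g => gmonom k g *~ lam g).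
pose U (c : k) (g : G) : A := << c *g g >>.
have dU c g : d (U c g) = c%:A * (gmonom k g *~ lam g) by exact: mmapU.
have dD a b : d (a + b) = d a + d b by exact: raddfD.
have d0 : d 0 = 0 by exact: raddf0.
have UE c g : U c g = c%:A * gmonom k g.
  by rewrite -scalerAl mul1r; apply/malgP => h; rewrite mcoeffZ !mcoeffU mulrnAr mulr1.
have sumE a : a = \sum_(g <- msupp a) U a@_g g by exact: monalgE.
have dM a b : d (a * b) = d a * b + a * d b.
  have dMU c g c' g' : d (U c g * U c' g') = d (U c g) * U c' g' + U c g * d (U c' g').
    rewrite [_ * U c' g']gmulUU -/(U _ _) !dU lamD mulrzDr !UE gmonomD.
    have -> : (c * c')%:A = c%:A * c'%:A :> A by rewrite -scalerAl mul1r scalerA.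
    exact: leibniz_mulz.
  have dMr a' c' g' : d (a' * U c' g') = d a' * U c' g' + a' * d (U c' g').
    rewrite [a']sumE; apply: (big_ind (fun x => d (x * U c' g') =
      d x * U c' g' + x * d (U c' g'))) => [|x y ex ey|g _]; last exact: dMU.
      by rewrite !mul0r d0 mul0r addr0.
    by rewrite mulrDl !dD ex ey !mulrDl addrACA.
  rewrite [b]sumE; apply: (big_ind (fun x => d (a * x) = d a * x + a * d x)).
  - by rewrite !mulr0 d0 mulr0 addr0.
  - by move=> x y ex ey; rewrite mulrDr !dD ex ey !mulrDr addrACA.
  - by move=> g _; exact: dMr.
have [D [derD DE]] := derivation_extends frac_iota dD dM.
exists D; split=> // [g|c]; rewrite DE.
  by rewrite -[gmonom k g]/(U 1 g) dU scale1r mul1r rmorphMz mulrzl.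
have -> : c%:A = U c 0 by rewrite UE mulr1.
by rewrite dU lam0 mulr0z mulr0 rmorph0.
Qed.

End EulerDerivation.

Section DerivationTheory.
Context (L : fieldType) (D : L -> L) (derD : derivation D).

Lemma derivation0 : D 0 = 0.
Proof. by have := derD.1 0 0; rewrite addr0 -[X in X = _]addr0 => /addrI. Qed.

Lemma derivation1 : D 1 = 0.
Proof. by have := derD.2 1 1; rewrite !mulr1 mul1r -[X in X = _]addr0 => /addrI. Qed.

Lemma derivation_div_eq0 u v : D u = 0 -> D v = 0 -> v != 0 -> D (u / v) = 0.
Proof.
move=> Du Dv v0; have := derD.2 (u / v) v.
by rewrite divfK // Du Dv mulr0 addr0 => /esym/eqP; rewrite mulf_eq0 (negbTE v0) orbF => /eqP.
Qed.

End DerivationTheory.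

Lemma derivation_sub_sum (L : fieldType) (I : eqType) (r : seq I) (c : I -> L)
    (D0 : L -> L) (D : I -> L -> L) :
  derivation D0 -> (forall i, derivation (D i)) ->
  derivation (fun v => D0 v - \sum_(i <- r) c i * D i v).
Proof.
move=> d0 dD; elim: r => [|i r [IHD IHM]].
  by split=> u v; rewrite !big_nil !subr0; [exact: d0.1|exact: d0.2].
have e v : D0 v - \sum_(j <- i :: r) c j * D j v =
    (D0 v - \sum_(j <- r) c j * D j v) - c i * D i v.
  by rewrite big_cons opprD addrCA addrC.
have [dDi dMi] := dD i.
by split=> u v; rewrite !e; [rewrite IHD dDi|rewrite IHM dMi]; ring.
Qed.

(** * Two families of monomials in one field *)
Section MonomialFrame.
Context (k : fieldType) (G : torsionFreeZmodType) (L : fieldType).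
Context (iota : {rmorphism group_algebra k G -> L}) (iotaP : fraction_field_of iota).
Local Notation A := (group_algebra k G).
Local Notation X g := (iota (gmonom k g)).
Local Notation cst c := (iota (c%:A : A)).

Lemma frame_eq0 a : (iota a == 0) = (a == 0).
Proof. by rewrite -(inj_eq iotaP.1) rmorph0. Qed.

Lemma monom_neq0 g : X g != 0.
Proof. by rewrite frame_eq0 monalgU_eq0 oner_eq0. Qed.

Lemma monomB a b : X (a - b) = X a / X b.
Proof.
apply: (mulIf (monom_neq0 b)); rewrite divfK ?monom_neq0 //.
by rewrite -rmorphM -gmonomD subrK.
Qed.

Lemma const_eq0 c : (cst c == 0) = (c == 0).
Proof. by rewrite frame_eq0 scaler_eq0 oner_eq0 orbF. Qed.

Lemma const_div c c' : cst (c / c') = cst c / cst c'.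
Proof. exact: (fmorph_div (iota \o in_alg A)). Qed.

Lemma constM c c' : cst (c * c') = cst c * cst c'.
Proof. exact: (rmorphM (iota \o in_alg A)). Qed.

Lemma frame_sum p : iota p = \sum_(g <- msupp p) cst p@_g * X g.
Proof.
rewrite {1}[p]gmonomE rmorph_sum; apply: eq_bigr => g _.
by rewrite -rmorphM -scalerAl mul1r.
Qed.

Lemma derivation_vanishes D p : derivation D -> (forall c, D (cst c) = 0) ->
  (forall g, g \in msupp p -> D (X g) = 0) -> D (iota p) = 0.
Proof.
move=> derD Dc DX; rewrite frame_sum big_seq.
apply: (big_ind (fun u => D u = 0)) => [|u v Du Dv|g gp].
- exact: derivation0.
- by rewrite derD.1 Du Dv addr0.
- by rewrite derD.2 Dc DX // mulr0 mul0r addr0.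
Qed.

Lemma monom_const_inj g c : X g = cst c -> g = 0.
Proof.
move/iotaP.1 => e; apply/eqP/contraT => g0.
have := congr1 (mcoeff g) e; rewrite mcoeffZ !mcoeffU eqxx.
by rewrite eq_sym (negbTE g0) mulr0 => /eqP; rewrite oner_eq0.
Qed.

End MonomialFrame.

(** Apply [relfree_mod_monomials] over the algebraic numbers, which contain the
    roots of unity. If p/q with rational coefficients equals c X^v, then p and q
    are related by a shift of exponents, so c is rational: enlarging the constants
    does not enlarge the subgroup modulo which freeness is asserted. *)
Theorem relfree_mod_frame (G : zmodType) (H : torsionFreeZmodType) (L : fieldType)
    (iota : {rmorphism group_algebra rat H -> L}) (X : G -> L) :
    fraction_field_of iota -> (forall a b, X (a - b) = X a / X b) ->
    (forall a, X a != 0) ->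
  relfree [set a | exists c h, c != 0 /\ X a = iota c%:A * iota (gmonom rat h)] setT.
Proof.
move=> iotaP XB X0.
have [f [finj fc fX fcoef]] := @group_algebra_map rat algC H H ratr idfun (@inj_id _).
pose M := @tofrac (group_algebra algC H).
have Minj : injective (M \o f) by move=> p q /(tofrac_fraction_field _).1 /finj.
have [F FE] := fraction_lift (f := M \o f : {rmorphism _ -> _}) iotaP Minj.
have roots n : (0 < n)%N -> exists z : algC, n.-primitive_root z.
  by move=> /C_prim_root_exists[z]; exists z.
have YB a b : (F \o X) (a - b) = (F \o X) a / (F \o X) b.
  by rewrite /= XB fmorph_div.
have Y0 a : (F \o X) a != 0 by rewrite fmorph_eq0.
have := relfree_mod_monomials roots YB Y0.
suff -> : [set a | exists (c : algC) v, c != 0 /\ (F \o X) a = fconst H c * fmonom algC v] =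
    [set a | exists c h, c != 0 /\ X a = iota c%:A * iota (gmonom rat h)] by [].
apply/seteqP; split=> a; last first.
  move=> [c [h [c0 e]]]; exists (ratr c), h; split; first by rewrite fmorph_eq0.
  by rewrite /= e rmorphM !FE /= fc fX.
move=> [c [v [c0 e]]]; have [p [q [q0 Xpq]]] : exists p q : group_algebra rat H,
  q != 0 /\ X a = iota p / iota q := iotaP.2 (X a).
have fq0 : f q != 0 by rewrite -(rmorph0 f) (inj_eq finj).
have e1 : f p = c%:A * gmonom algC v * f q.
  apply: (tofrac_fraction_field _).1; rewrite !tofracM.
  have := e; rewrite /= Xpq fmorph_div !FE /= => /(canRL (divfK _)) -> //.
  by rewrite tofrac_eq0.
have [h qh] := nonzero_mcoeff q0.
have e2 : ratr (p@_(h + v)) = c * ratr (q@_h) :> algC.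
  rewrite -!fcoef /= e1 -mulrA -scalerAl mul1r mcoeffZ mulrC [gmonom _ _ * _]mulrC.
  by rewrite mcoeffM_monom addrK mulrC.
have [b cE] : exists b : rat, c = ratr b.
  exists (p@_(h + v) / q@_h).
  rewrite (fmorph_div (ratr : {rmorphism rat -> algC})).
  by apply: (canRL (mulfK _)); [rewrite fmorph_eq0|exact: esym e2].
exists b, v; split; first by move: c0; rewrite cE fmorph_eq0.
have fcb : f b%:A = c%:A by rewrite fc cE.
by apply: (fmorph_inj F); rewrite rmorphM !FE /= fcb fX; exact: e.
Qed.

Section TwoFrames.
Context (k : fieldType) (L : fieldType).

Definition comonomial (G H : torsionFreeZmodType) (iG : group_algebra k G -> L)
    (iH : group_algebra k H -> L) (g : G) (h : H) :=
  exists2 c : k, c != 0 & iG (gmonom k g) = iH c%:A * iH (gmonom k h).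

(** The subgroup of the exponents of monomials that both families share up to
    constants. *)
Definition common (G H : torsionFreeZmodType) (iG : group_algebra k G -> L)
    (iH : group_algebra k H -> L) : set G := [set g | exists h, comonomial iG iH g h].

Context (G H : torsionFreeZmodType).
Context (iG : {rmorphism group_algebra k G -> L}) (iH : {rmorphism group_algebra k H -> L}).
Hypotheses (iGP : fraction_field_of iG) (iHP : fraction_field_of iH).
Hypothesis same_const : forall c : k, iG c%:A = iH c%:A.
Local Notation X g := (iG (gmonom k g)).
Local Notation Y h := (iH (gmonom k h)).

Lemma comonomialB g g' h h' : comonomial iG iH g h -> comonomial iG iH g' h' ->
  comonomial iG iH (g - g') (h - h').
Proof.
move=> [c c0 e] [c' c'0 e']; exists (c / c'); first by rewrite mulf_neq0 ?invr_eq0.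
by rewrite !monomB // e e' const_div invfM mulrACA.
Qed.

Lemma comonomial0 : comonomial iG iH 0 0.
Proof.
exists 1; first exact: oner_neq0.
by rewrite scale1r !(rmorph1 iH) mul1r gmonom0 !rmorph1.
Qed.

Lemma comonomial_sym g h : comonomial iG iH g h -> comonomial iH iG h g.
Proof.
move=> [c c0 e]; exists c^-1; first by rewrite invr_eq0.
rewrite e same_const mulrA -constM // mulVf // scale1r.
by rewrite (rmorph1 iH) mul1r.
Qed.

Lemma common_zsubgroup : zsubgroup (common iG iH).
Proof.
split; first by exists 0; exact: comonomial0.
by move=> a b [h ah] [h' bh']; exists (h - h'); exact: comonomialB.
Qed.

Lemma comonomial_inj h : comonomial iG iH 0 h -> h = 0.
Proof.
move=> [c c0]; rewrite gmonom0 rmorph1 => e; apply: (@monom_const_inj _ _ _ _ iHP _ c^-1).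
have := const_eq0 iHP c; rewrite (negbTE c0) => /negbT cn.
apply: (mulfI cn); rewrite -e -constM // mulfV // scale1r.
by rewrite (rmorph1 iH).
Qed.

End TwoFrames.

(** * Equality of ranks *)
Section BasisInjection.
Context (k : fieldType) (L : fieldType) (G H : torsionFreeZmodType).
Context (iG : {rmorphism group_algebra k G -> L}) (iH : {rmorphism group_algebra k H -> L}).
Hypotheses (iGP : fraction_field_of iG) (iHP : fraction_field_of iH).
Hypothesis same_const : forall c : k, iG c%:A = iH c%:A.
Local Notation X g := (iG (gmonom k g)).
Local Notation Y h := (iH (gmonom k h)).
Context (EG : set G) (EH : set H).
Hypotheses (bG : basis_mod (common iG iH) EG setT) (bH : basis_mod (common iH iG) EH setT).

(** Let D_a and D'_b be the Euler derivations dual to the two bases. All of them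
    kill the common monomials, so D_a is the sum over b of (D_a Y^b / Y^b) D'_b
    on the monomials X^u in question. Evaluating at X^a' shows that the matrix of
    the D'_b X^a / X^a has a left inverse. Its a-th column vanishes outside the
    finite set S a of the basis elements involved in X^a. *)
Lemma basis_injection :
  exists f : G -> H, {in EG &, injective f} /\ forall a, EG a -> EH (f a).
Proof.
have [lam [lamB lamN lamE _]] := dual_basis (common_zsubgroup iGP iHP) bG.
have [mu [muB muN muE muP]] := dual_basis (common_zsubgroup iHP iGP) bH.
have [DG DGP] := choice (fun a => euler_derivation iGP (lamB a)).
have [DH DHP] := choice (fun b => euler_derivation iHP (muB b)).
have [T TP] := choice muP.
have [num numP] : {f : G -> group_algebra k H * group_algebra k H &
    forall a, (f a).2 != 0 /\ X a = iH (f a).1 / iH (f a).2}.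
  apply: (@choice _ _ (fun a f => f.2 != 0 /\ X a = iH f.1 / iH f.2)) => a.
  by have [p [q pq]] := iHP.2 (X a); exists (p, q).
pose supp a : seq H := msupp (num a).1 ++ msupp (num a).2.
pose S a := flatten [seq T h | h <- supp a].
have S_EH a b : b \in S a -> EH b.
  by move=> /flatten_mapP[h _ bT]; have [_ ThE _ _] := TP h; exact: ThE.
have vanish D a : derivation D -> (forall c, D (iH (c%:A : group_algebra k H)) = 0) ->
    (forall h, h \in supp a -> D (Y h) = 0) -> D (X a) = 0.
  move=> derD Dc DY; have [q0 ->] := numP a.
  apply: derivation_div_eq0 => //; last by rewrite frame_eq0.
    by apply: derivation_vanishes => // h hp; apply: DY; rewrite mem_cat hp.
  by apply: derivation_vanishes => // h hp; apply: DY; rewrite mem_cat hp orbT.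
have DH_out a b : b \notin S a -> DH b (X a) = 0.
  move=> nbS; have [derD DY Dc] := DHP b; apply: vanish => // h ha.
  rewrite DY; have -> : mu b h = 0; last by rewrite mul0r.
  apply/eqP; apply: contraNT nbS => mbh; apply/flatten_mapP; exists h => //.
  by have [_ _ + _] := TP h; apply.
have [|f [finj fS]] := @infinite_matching G H EG S; last first.
  by exists f; split=> // a /fS; exact: S_EH.
move=> s0 s0E; pose s := undup s0; pose t := undup (flatten [seq S a | a <- s]).
have sE a : a \in s -> EG a by rewrite mem_undup; exact: s0E.
have tE b : b \in t -> EH b by rewrite mem_undup => /flatten_mapP[a _ /S_EH].
have St a : a \in s -> {subset S a <= t}.
  by move=> as_ b bS; rewrite mem_undup; apply/flatten_mapP; exists a.
have us : uniq s by exact: undup_uniq.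
have ut : uniq t by exact: undup_uniq.
(* The chain rule holds because the difference of its two sides is a derivation
   that kills every monomial entering X u. *)
have chain a u : EG a -> u \in s ->
    DG a (X u) = \sum_(b <- t) DG a (Y b) / Y b * DH b (X u).
  move=> aE us'; have [derG DX DGc] := DGP a.
  pose D v := DG a v - \sum_(b <- t) DG a (Y b) / Y b * DH b v.
  have derD : derivation D.
    by apply: derivation_sub_sum => // b; have [] := DHP b.
  suff : D (X u) = 0 by move/eqP; rewrite subr_eq0 => /eqP.
  have Dconst (c : k) : D (iH (c%:A : group_algebra k H)) = 0.
    rewrite /D -{1}same_const DGc big1 ?subr0 // => b _.
    by have [_ _ ->] := DHP b; rewrite mulr0.
  have gZ : zsubgroup [set h | D (Y h) = 0].
    split; first by rewrite /= gmonom0 rmorph1 (derivation1 derD).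
    move=> h h' /= Dh Dh'; rewrite monomB //.
    by apply: derivation_div_eq0 => //; exact: monom_neq0.
  have Dcommon h : common iH iG h -> D (Y h) = 0.
    move=> hN; have [g [c c0 e]] := hN.
    rewrite /D big1 ?subr0 => [|b _].
      rewrite e derG.2 DGc DX lamN ?mul0r ?mulr0 ?addr0 //.
      by exists h; apply: comonomial_sym => //; exists c.
    by have [_ -> _] := DHP b; rewrite muN // mul0r mulr0.
  have Dbasis b : b \in t -> D (Y b) = 0.
    move=> bt; rewrite /D (bigD1_seq b) //= big1 ?addr0 => [|b' b'b].
      have [_ -> _] := DHP b; rewrite muE ?eqxx ?mul1r; last exact: tE.
      by rewrite divfK ?subrr // monom_neq0.
    have [_ -> _] := DHP b'; rewrite muE; last exact: tE.
    by rewrite eq_sym (negbTE b'b) mul0r mulr0.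
  apply: vanish => // h hu; have [_ _ _ hT] := TP h.
  rewrite -[h](subrK (lincomb (T h) (mu^~ h))).
  apply: (zsubgroupD gZ); first exact: Dcommon.
  apply: (zsubgroup_sum gZ) => b bT; apply: (zsubgroupMz _ gZ); apply: Dbasis.
  by apply: (St u) => //; apply/flatten_mapP; exists h.
pose B := \matrix_(i < size s, j < size t) (DG (nth 0 s i) (Y (nth 0 t j)) / Y (nth 0 t j)).
pose M := \matrix_(j < size t, i < size s) (DH (nth 0 t j) (X (nth 0 s i)) / X (nth 0 s i)).
have BM : B *m M = 1%:M.
  apply/matrixP => i i'; rewrite !mxE.
  have si := mem_nth 0 (ltn_ord i); have si' := mem_nth 0 (ltn_ord i').
  have [_ DX _] := DGP (nth 0 s i).
  have e := chain _ _ (sE _ si) si'.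
  have X0 := monom_neq0 iGP (nth 0 s i').
  transitivity (DG (nth 0 s i) (X (nth 0 s i')) / X (nth 0 s i')).
    rewrite e (big_nth 0) big_mkord mulr_suml; apply: eq_bigr => l _.
    by rewrite !mxE mulrA.
  rewrite DX mulfK // lamE ?nth_uniq //; last exact: sE.
  by rewrite eq_sym -[i == i' :> nat]/(i == i'); case: (i == i').
have [f finj fM] := left_inverse_matching BM.
have idx a : a \in s0 -> (index a s < size s)%N.
  by move=> as_; rewrite index_mem mem_undup.
pose pick a : H := if insub (index a s) is Some i then nth 0 t (f i) else 0.
have pickE a (as_ : a \in s0) : pick a = nth 0 t (f (Ordinal (idx _ as_))).
  by rewrite /pick (insubT (fun i => i < size s)%N (idx _ as_)).
exists pick; split=> [a a' as_ as'|a as_].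
  rewrite !pickE => /eqP; rewrite nth_uniq // => /eqP/val_inj/finj[].
  move=> e; rewrite -[a](@nth_index _ 0 _ s) ?mem_undup // e nth_index ?mem_undup //.
rewrite pickE; apply: contraT => /DH_out e.
have := fM (Ordinal (idx _ as_)); rewrite mxE /= nth_index ?mem_undup //.
by rewrite e mul0r eqxx.
Qed.

End BasisInjection.

(** * The isomorphism *)
Section Assembly.
Context (k : fieldType) (L : fieldType) (G H : torsionFreeZmodType).
Context (iG : {rmorphism group_algebra k G -> L}) (iH : {rmorphism group_algebra k H -> L}).
Hypotheses (iGP : fraction_field_of iG) (iHP : fraction_field_of iH).
Hypothesis same_const : forall c : k, iG c%:A = iH c%:A.
Context (EG : set G) (EH : set H).
Hypotheses (bG : basis_mod (common iG iH) EG setT) (bH : basis_mod (common iH iG) EH setT).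
Context (phi : G -> H).
Hypotheses (phiE : forall e, EG e -> EH (phi e)) (phi_inj : {in EG &, injective phi}).
Hypothesis phi_surj : forall b, EH b -> exists2 e, EG e & phi e = b.

(** The graph of the isomorphism: the subgroup of G x H generated by the pairs of
    proportional monomials and by the pairs (e, phi e). Being defined by
    minimality, it is total on both sides as soon as the bases span. *)
Definition paired g h := forall P : G -> H -> Prop, P 0 0 ->
  (forall g g' h h', P g h -> P g' h' -> P (g - g') (h - h')) ->
  (forall g h, comonomial iG iH g h -> P g h) -> (forall e, EG e -> P e (phi e)) -> P g h.

Lemma paired0 : paired 0 0. Proof. by []. Qed.

Lemma pairedB g g' h h' : paired g h -> paired g' h' -> paired (g - g') (h - h').
Proof. by move=> r r' P P0 PB Pc PE; apply: (PB); [exact: r|exact: r']. Qed.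

Lemma paired_comonomial g h : comonomial iG iH g h -> paired g h.
Proof. by move=> c P _ _ Pc _; exact: Pc. Qed.

Lemma paired_basis e : EG e -> paired e (phi e).
Proof. by move=> c P _ _ _; apply. Qed.

Lemma paired_total g : exists h, paired g h.
Proof.
have [_ _ span] := bG; apply: (span [set g | exists h, paired g h]) => //.
- split; first by exists 0; exact: paired0.
  by move=> a b [h ah] [h' bh']; exists (h - h'); exact: pairedB.
- by move=> a [h ah]; exists h; exact: paired_comonomial.
- by move=> e Ee; exists (phi e); exact: paired_basis.
Qed.

Lemma paired_surj h : exists g, paired g h.
Proof.
have [_ _ span] := bH; apply: (span [set h | exists g, paired g h]) => //.
- split; first by exists 0; exact: paired0.
  by move=> a b [g ag] [g' bg']; exists (g - g'); exact: pairedB.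
- move=> a [g ag]; exists g; apply: paired_comonomial.
  by apply: comonomial_sym => // c; rewrite same_const.
- by move=> b /phi_surj[e Ee <-]; exists e; exact: paired_basis.
Qed.

Let sum_widen (V : zmodType) (F : G -> V) (s t : seq G) (m : G -> int) :
  uniq s -> uniq t -> {subset s <= t} ->
  \sum_(e <- t) F e *~ (if e \in s then m e else 0) = \sum_(e <- s) F e *~ m e.
Proof.
move=> us ut st; rewrite (bigID (mem s)) /= [X in _ + X]big1 ?addr0; last first.
  by move=> e /negbTE->; rewrite mulr0z.
rewrite -big_filter; under eq_big_seq => e.
  by rewrite mem_filter => /andP[/= -> _]; over.
apply/perm_big/uniq_perm => //; first exact: filter_uniq.
move=> e; rewrite mem_filter /=; case es : (e \in s) => //=; exact: st.
Qed.

Lemma pairedP g h : paired g h -> exists s m, [/\ uniq s, forall e, e \in s -> EG e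
  & comonomial iG iH (g - \sum_(e <- s) e *~ m e) (h - \sum_(e <- s) phi e *~ m e)].
Proof.
move=> r; apply: (r (fun g h => exists s m, [/\ uniq s, forall e, e \in s -> EG e
  & comonomial iG iH (g - \sum_(e <- s) e *~ m e) (h - \sum_(e <- s) phi e *~ m e)]))
  => {r g h}.
- by exists [::], (fun _ => 0); rewrite !big_nil !subr0; split=> //; exact: comonomial0.
- move=> g g' h h' [s [m [us sE c]]] [s' [m' [us' s'E c']]].
  pose t := undup (s ++ s').
  have ut : uniq t by exact: undup_uniq.
  have st : {subset s <= t} by move=> x xs; rewrite mem_undup mem_cat xs.
  have s't : {subset s' <= t} by move=> x xs; rewrite mem_undup mem_cat xs orbT.
  exists t, (fun e => (if e \in s then m e else 0) - (if e \in s' then m' e else 0)).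
  split=> //; first by move=> x; rewrite mem_undup mem_cat => /orP[/sE|/s'E].
  have sub (V : zmodType) (F : G -> V) a b : a - b - \sum_(e <- t) F e *~
      ((if e \in s then m e else 0) - (if e \in s' then m' e else 0)) =
      (a - \sum_(e <- s) F e *~ m e) - (b - \sum_(e <- s') F e *~ m' e).
    under eq_bigr do rewrite mulrzBr.
    rewrite sumrB !sum_widen // !opprB addrACA [RHS]addrACA; congr (_ + _).
    exact: addrC.
  by rewrite !sub; exact: comonomialB.
- by move=> g h c; exists [::], (fun _ => 0); rewrite !big_nil !subr0.
- move=> e Ee; exists [:: e], (fun _ => 1); rewrite !big_seq1 !mulr1z !subrr.
  by split=> //; [move=> x; rewrite inE => /eqP->|exact: comonomial0].
Qed.

(** Single-valuedness: a pair (0, h) gives a relation between the elements of the basis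
    modulo the common subgroup, so all coefficients vanish and Y^h is constant. *)
Lemma paired_0l h : paired 0 h -> h = 0.
Proof.
move=> /pairedP[s [m [us sE c]]]; have [_ indep _] := bG.
have m0 : forall e, e \in s -> m e = 0.
  apply: indep => //; rewrite -[lincomb _ _]opprK; apply: zsubgroupN.
    exact: common_zsubgroup.
  by move: c; rewrite sub0r => c; eexists; exact: c.
apply: (comonomial_inj (iG := iG) iHP); move: c.
by rewrite !big_seq !big1 ?subr0 // => e /m0->; rewrite mulr0z.
Qed.

Lemma paired_0r g : paired g 0 -> g = 0.
Proof.
move=> /pairedP[s [m [us sE c]]]; have [_ indep _] := bH.
have [psi psiP] : {psi : H -> G & forall b, EH b -> EG (psi b) /\ phi (psi b) = b}.
  apply: (@choice _ _ (fun b e => EH b -> EG e /\ phi e = b)) => b.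
  have [/phi_surj[e Ee eb]|nb] := pselect (EH b); first by exists e.
  by exists 0.
have psiK e : EG e -> psi (phi e) = e.
  move=> Ee; have [Ep ep] := psiP _ (phiE Ee).
  by apply: phi_inj; rewrite ?inE.
have c' := comonomial_sym same_const c.
have m0 : forall b, b \in map phi s -> m (psi b) = 0.
  apply: (indep _ (m \o psi)).
  - rewrite map_inj_in_uniq // => e e' es e's.
    by apply: phi_inj; rewrite inE; exact: sE.
  - by move=> _ /mapP[e /sE Ee ->]; exact: phiE.
  have -> : lincomb (map phi s) (m \o psi) = \sum_(e <- s) phi e *~ m e.
    rewrite /lincomb big_map; apply: eq_big_seq => e /sE Ee /=.
    by rewrite psiK.
  rewrite -[\sum_(_ <- _) _]opprK; apply: zsubgroupN; first exact: common_zsubgroup.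
  by move: c'; rewrite sub0r => c'; eexists; exact: c'.
have {}m0 e : e \in s -> m e = 0.
  by move=> es; rewrite -(psiK _ (sE _ es)) m0 // map_f.
apply: (comonomial_inj (iG := iH) iGP); move: c'.
by rewrite !big_seq !big1 ?subr0 // => e /m0->; rewrite mulr0z.
Qed.

Lemma frames_isomorphic : group_isomorphic G H.
Proof.
have [f fP] := choice paired_total; have [f' f'P] := choice paired_surj.
have uniq_r g h h' : paired g h -> paired g h' -> h = h'.
  move=> r r'; apply/eqP; rewrite -subr_eq0; apply/eqP/paired_0l.
  by rewrite -(subrr g); exact: pairedB.
have uniq_l g g' h : paired g h -> paired g' h -> g = g'.
  move=> r r'; apply/eqP; rewrite -subr_eq0; apply/eqP/paired_0r.
  by rewrite -(subrr h); exact: pairedB.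
have fB : zmod_morphism f by move=> a b; apply: uniq_r (fP _) (pairedB _ _).
pose fA := GRing.isZmodMorphism.Build _ _ f fB.
exists (HB.pack f fA : {additive G -> H}); exists f' => x /=.
  exact: uniq_l (f'P _) (fP _).
exact: uniq_r (fP _) (f'P _).
Qed.

End Assembly.

Lemma card_le_injection (T U : Type) (A : set T) (B : set U) (f : T -> U) :
  {in A &, injective f} -> (forall a, A a -> B (f a)) -> (A #<= B)%card.
Proof.
move=> finj fAB; have /card_eqPle[_ AfA] := inj_card_eq finj.
apply: (card_le_trans AfA); apply: subset_card_le.
by move=> _ [a Aa <-]; exact: fAB.
Qed.

Lemma group_isomorphic_of_field (G H : torsionFreeZmodType) :
  field_isomorphic (group_algebra_frac rat G) (group_algebra_frac rat H) ->
  group_isomorphic G H.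
Proof.
move=> [f fbij]; have [f' fK f'K] := fbij.
pose iH : {rmorphism group_algebra rat H -> group_algebra_frac rat H} := @tofrac _.
pose iG : {rmorphism group_algebra rat G -> group_algebra_frac rat H} :=
  f \o @tofrac (group_algebra rat G).
have iHP : fraction_field_of iH by exact: tofrac_fraction_field.
have iGP : fraction_field_of iG.
  have [tinj tfrac] := tofrac_fraction_field (group_algebra rat G).
  split; first by move=> p q /fmorph_inj/tinj.
  move=> u; have [p [q [q0 e]]] := tfrac (f' u); exists p, q; split=> //.
  by rewrite -[LHS]f'K e fmorph_div.
have same_const (c : rat) : iG c%:A = iH c%:A.
  have eG := fmorph_eq_rat (iG \o in_alg _ : {rmorphism rat -> _}) c.
  have eH := fmorph_eq_rat (iH \o in_alg _ : {rmorphism rat -> _}) c.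
  by rewrite -[LHS]/((iG \o in_alg _) c) -[RHS]/((iH \o in_alg _) c) eG eH.
have free (A B : torsionFreeZmodType) (L : fieldType)
    (iA : {rmorphism group_algebra rat A -> L}) (iB : {rmorphism group_algebra rat B -> L}) :
    fraction_field_of iA -> fraction_field_of iB -> relfree (common iA iB) setT.
  move=> iAP iBP.
  have := relfree_mod_frame iBP (monomB iAP) (monom_neq0 iAP).
  suff -> : common iA iB = [set a | exists c h, c != 0 /\
      iA (gmonom rat a) = iB c%:A * iB (gmonom rat h)] by [].
  apply/seteqP; split=> a; first by move=> [h [c c0 e]]; exists c, h.
  by move=> [c [h [c0 e]]]; exists h, c.
have [EG bG] := free _ _ _ _ _ iGP iHP; have [EH bH] := free _ _ _ _ _ iHP iGP.
have [u [uinj uE]] := basis_injection iGP iHP same_const bG bH.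
have [v [vinj vE]] := basis_injection iHP iGP (fun c => esym (same_const c)) bH bG.
have : (EG #= EH)%card.
  by apply: Cantor_Bernstein;
    [exact: card_le_injection uinj uE|exact: card_le_injection vinj vE].
pose pH : pointedType :=
  HB.pack (TorsionFreeZmodule.sort H) (isPointed.Build (TorsionFreeZmodule.sort H) 0).
move/(@card_set_bijP _ pH EG EH) => [phi [phiE phi_inj phi_surj]].
apply: (frames_isomorphic iGP iHP same_const bG bH (phi := phi)) => //.
Qed.

Lemma field_isomorphic_of_group (G H : torsionFreeZmodType) :
  group_isomorphic G H ->
  field_isomorphic (group_algebra_frac rat G) (group_algebra_frac rat H).
Proof.
move=> [phi [psi phiK psiK]].
have [f [finj fc fX _]] := group_algebra_map (idfun : {rmorphism rat -> rat}) (can_inj phiK).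
pose M := @tofrac (group_algebra rat H).
have Minj : injective (M \o f) by move=> p q /(tofrac_fraction_field _).1 /finj.
have [F FE] := fraction_lift (f := M \o f : {rmorphism _ -> _}) (tofrac_fraction_field _) Minj.
have surj u : exists v, F v = u.
  apply: (@fracs_min rat H setT [set u | exists v, F v = u]) (fracs_full u) => //.
  - by exists 0; rewrite rmorph0.
  - by move=> _ _ [v <-] [w <-]; exists (v + w); rewrite rmorphD.
  - by move=> _ _ [v <-] [w <-]; exists (v / w); rewrite fmorph_div.
  - move=> c h _; exists (fconst G c * fmonom rat (psi h)).
    by rewrite rmorphM !FE /= fc fX psiK.
have [F' F'K] := choice surj.
exists F; exists F' => [v|//]; apply: (fmorph_inj F); exact: F'K.
Qed.

Theorem theorem1p1 (G H : torsionFreeZmodType) :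
  field_isomorphic (group_algebra_frac rat G) (group_algebra_frac rat H) <->
  group_isomorphic G H.
Proof.
split; first exact: group_isomorphic_of_field.
exact: field_isomorphic_of_group.
Qed.
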